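(* There is a universal constant $C>0$ such that for all integers $d_{\mathrm{in}},d_{\mathrm{out}}\ge1$ and every $\varepsilon>0$ there is an incoherent ancilla-free algorithm using a number of measurements $$N\le C\,\frac{d_{\mathrm{in}}^2\,d_{\mathrm{out}}^{1.5}}{\varepsilon^2}$$ which, given access to an unknown $(d_{\mathrm{in}},d_{\mathrm{out}})$-dimensional quantum channel $\mathcal{N}$, distinguishes between $\mathcal{N}=\mathcal{D}$ and $d_\diamond(\mathcal{N},\mathcal{D})\ge\varepsilon$ with success probability at least $2/3$ (under each hypothesis), where $\mathcal{D}(\rho)=\mathrm{Tr}(\rho)\frac{\mathbb{I}}{d_{\mathrm{out}}}$ is the completely depolarizing channel.
   Context: A $(d_{\mathrm{in}},d_{\mathrm{out}})$-dimensional quantum channel is a map $\mathcal{N}:\mathbb{C}^{d_{\mathrm{in}}\times d_{\mathrm{in}}}\to\mathbb{C}^{d_{\mathrm{out}}\times d_{\mathrm{out}}}$ of the form $\mathcal{N}(\rho)=\sum_k A_k\rho A_k^\dagger$ with $\sum_k A_k^\dagger A_k=\mathbb{I}$. A quantum state is a positive semidefinite matrix of trace 1. Diamond distance: $d_\diamond(\mathcal{N},\mathcal{M})=\max_\rho\|(\mathrm{id}_{d_{\mathrm{in}}}\otimes(\mathcal{N}-\mathcal{M}))(\rho)\|_1$ over quantum states $\rho$ on $\mathbb{C}^{d_{\mathrm{in}}}\otimes\mathbb{C}^{d_{\mathrm{in}}}$, where $\|\cdot\|_1$ is the Schatten 1-norm. A POVM is a finite family $\{M_x\}_{x}$ of positive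 semidefinite matrices with $\sum_x M_x=\mathbb{I}$; measuring a state $\rho$ with it gives outcome $x$ with probability $\mathrm{Tr}(\rho M_x)$. Incoherent ancilla-free algorithm with $N$ measurements: at each step $t=1,\dots,N$ the algorithm chooses an input state $\rho_t$ on $\mathbb{C}^{d_{\mathrm{in}}}$ and a POVM $\{M^t_x\}_x$ on $\mathbb{C}^{d_{\mathrm{out}}}$ (possibly randomly, and possibly depending on previous outcomes), and observes outcome $x_t$ with probability $\mathrm{Tr}(\mathcal{N}(\rho_t)M^t_{x_t})$. After $N$ steps it processes $(x_1,\dots,x_N)$ classically and outputs one of the two hypotheses. *)

(* Defs.v *)
From HB Require Import structures.
From mathcomp Require Import all_boot all_order all_algebra.
From mathcomp Require Import spectral.
From mathcomp Require Import complex mxtens.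
From mathcomp Require Import all_classical all_reals all_analysis.

Set Implicit Arguments.
Unset Strict Implicit.
Unset Printing Implicit Defensive.

Import Order.TTheory GRing.Theory Num.Theory.
Local Open Scope classical_set_scope.
Local Open Scope ring_scope.
Local Open Scope sesquilinear_scope.

Section Channels.
Variable R : realType.
Local Notation C := R[i].

(* The order on C makes 0 <= z mean that z is real and nonnegative. *)
Definition is_psd (n : nat) (A : 'M[C]_n) : Prop :=
  A^t* = A /\ forall v : 'cV[C]_n, 0 <= (v^t* *m A *m v) 0 0.

Definition is_state (n : nat) (rho : 'M[C]_n) : Prop :=
  is_psd rho /\ \tr rho = 1.

Definition is_povm (n : nat) (X : finType) (M : X -> 'M[C]_n) : Prop :=
  (forall x, is_psd (M x)) /\ \sum_x M x = 1%:M.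

Definition is_channel (din dout : nat) (Phi : 'M[C]_din -> 'M[C]_dout) : Prop :=
  exists (K : nat) (A : 'I_K -> 'M[C]_(dout, din)),
    (forall rho, Phi rho = \sum_k A k *m rho *m (A k)^t*) /\
    \sum_k (A k)^t* *m A k = 1%:M.

Definition depolarizing (din dout : nat) (rho : 'M[C]_din) : 'M[C]_dout :=
  (\tr rho / dout%:R)%:M.

(* Sum of the singular values of A, i.e. of the square roots of the
   eigenvalues, with multiplicity, of the Hermitian matrix A^t* *m A. *)
Definition schatten1 (n : nat) (A : 'M[C]_n) : R :=
  \sum_(i < n) Num.sqrt (complex.Re (spectral_diag (A^t* *m A) 0 i)).

(* The matrix rho_ij in rho = \sum_(i, j) delta_mx i j *t rho_ij. *)
Definition tens_block (n m : nat) (rho : 'M[C]_(n * m)) (i j : 'I_n) : 'M[C]_m :=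
  \matrix_(k, l) rho (mxtens_index (i, k)) (mxtens_index (j, l)).

(* id_n (x) Phi; meaningful for linear Phi. *)
Definition id_tens (n m p : nat) (Phi : 'M[C]_m -> 'M[C]_p)
    (rho : 'M[C]_(n * m)) : 'M[C]_(n * p) :=
  \sum_(i < n) \sum_(j < n) tensmx (delta_mx i j) (Phi (tens_block rho i j)).

Definition diamond_dist (din dout : nat)
    (Phi Psi : 'M[C]_din -> 'M[C]_dout) : R :=
  sup [set schatten1 (id_tens (fun X => Phi X - Psi X) rho)
      | rho in [set rho : 'M[C]_(din * din) | is_state rho]].

(* All the randomness of the algorithm is carried by a seed w, drawn once and
   visible at every step and to the final processing; randomness that is fresh
   at each step is the special case where w has one component per step.
   The list argument of [input] and [meas] is the list of past outcomes, oldest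
   first.  A single finite outcome set is no restriction: POVMs with fewer
   outcomes are padded with zero operators.
   The verdict [true] stands for "the channel is depolarizing", [false] for "it
   is far from depolarizing". *)
Record algorithm (din dout N : nat) := Algorithm {
  seed_display : measure_display;
  seed : measurableType seed_display;
  seed_law : probability seed R;
  outcome : finType;
  input : seed -> seq outcome -> 'M[C]_din;
  meas : seed -> seq outcome -> outcome -> 'M[C]_dout;
  verdict : seed -> N.-tuple outcome -> bool;
  input_state : forall w h, is_state (input w h);
  meas_povm : forall w h, is_povm (meas w h);
  measurable_input : forall h i j,
    measurable_fun [set: seed] (fun w => complex.Re (input w h i j)) /\
    measurable_fun [set: seed] (fun w => complex.Im (input w h i j));
  measurable_meas : forall h x i j,
    measurable_fun [set: seed] (fun w => complex.Re (meas w h x i j)) /\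
    measurable_fun [set: seed] (fun w => complex.Im (meas w h x i j));
  measurable_verdict : forall x, measurable [set w : seed | verdict w x]
}.

Definition transcript_prob (din dout N : nat) (A : algorithm din dout N)
    (Phi : 'M[C]_din -> 'M[C]_dout) (w : seed A)
    (x : N.-tuple (outcome A)) : R :=
  \prod_(t < N)
    complex.Re (\tr (Phi (input w (take t x)) *m meas w (take t x) (tnth x t))).

Definition verdict_prob (din dout N : nat) (A : algorithm din dout N)
    (Phi : 'M[C]_din -> 'M[C]_dout) (b : bool) : \bar R :=
  \int[seed_law A]_w
    (\sum_(x : N.-tuple (outcome A) | verdict w x == b)
       transcript_prob Phi w x)%:E.

End Channels.

(* Main.v *)
(* The algorithm draws a constant number k of random pairs (input state, measurement basis) and
   runs a uniformity test for each pair.  Inputs are rank-one states with random phases in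
   {+-1 +- i}, together with random diagonal states; measurements are in the computational
   basis and in a Fourier basis twisted by random phases.  For D := N - depolarizing with Choi
   matrix C, the squared l2 distance delta^2 of the outcome distribution from uniform is the
   sum of squares of polynomials in independent signs, of mean at least
   |C|_2^2 / (4 d_in^2 d_out).  Hypercontractivity bounds its second moment by a constant
   times the squared mean, so averaging over k pairs concentrates.  Hoelder's inequality
   |Y Z|_1 <= |Y|_2 |Z|_2 applied to (id (x) D)(rho) gives diamond^2 <= d_out |C|_2^2.
   Counting collisions between two groups of m samples per pair has mean m^2 delta^2 above
   the uniform value and standard deviation about m / sqrt d_out, so that
   m of order d_in^2 d_out^(3/2) / eps^2 suffices by Chebyshev's inequality. *)

Require Import Defs.
From HB Require Import structures.
From mathcomp Require Import all_boot all_order all_algebra.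
From mathcomp Require Import spectral cyclic separable cyclotomic.
From mathcomp Require Import complex mxtens.
From mathcomp Require Import all_classical all_reals all_analysis.
From mathcomp Require Import ring lra.
Import Order.TTheory GRing.Theory Num.Theory.
Local Open Scope ring_scope.

(** * Expectations over finite products and the collision statistic *)

(** Each seed is used in four tests because no single pair sees the whole Choi matrix. A phase state
    reveals the images of the off-diagonal matrix units but only the sum of the images of the
    diagonal ones, which the random diagonal states separate. The computational basis reveals the
    diagonal of an output, the twisted Fourier basis its off-diagonal part, diluted over d_out
    outcomes. Phases take four values because with plain signs the units E_ij and E_ji could not be
    told apart. Taking them from a finite set, and not Haar distributed, turns every average over
    seeds into a finite sum and every deviation of a probability into a polynomial of degree at most
    2 in the input bits and 2 in the basis bits, hence a moment factor 9^2 = 81 for each. Two groups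
    of samples make the statistic bilinear in independent data of equal law, so that its second
    moment only involves second moments of the counts. The moment bounds on the signal are relative
    to its unknown mean; this is why a threshold set by a lower bound of that mean works for every
    far channel. *)

Section Expectation.
Context {R : realFieldType}.
Implicit Types T J Z : finType.

Definition expect {T} (q F : T -> R) : R := \sum_t q t * F t.

Lemma sum_pairE {V : nmodType} {A B : finType} (F : A * B -> V) :
  \sum_a F a = \sum_a \sum_b F (a, b).
Proof. by rewrite pair_bigA; apply: eq_bigr => -[]. Qed.

Lemma eq_expect {T} (q F G : T -> R) : F =1 G -> expect q F = expect q G.
Proof. by move=> FG; apply: eq_bigr => t _; rewrite FG. Qed.

Lemma expectD {T} (q F G : T -> R) :
  expect q (fun t => F t + G t) = expect q F + expect q G.
Proof. by rewrite -big_split; apply: eq_bigr => t _; rewrite mulrDr. Qed.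

Lemma expectZ {T} (q F : T -> R) a :
  expect q (fun t => a * F t) = a * expect q F.
Proof. by rewrite mulr_sumr; apply: eq_bigr => t _; rewrite mulrCA. Qed.

Lemma expect_sum {T} {I : finType} (q : T -> R) (F : I -> T -> R) :
  expect q (fun t => \sum_i F i t) = \sum_i expect q (F i).
Proof.
by rewrite /expect exchange_big; apply: eq_bigr => t _; rewrite mulr_sumr.
Qed.

Lemma expect_cst {T} (q : T -> R) a : \sum_t q t = 1 -> expect q (fun=> a) = a.
Proof. by move=> q1; rewrite /expect -mulr_suml q1 mul1r. Qed.

Lemma ler_expect {T} (q F G : T -> R) :
  (forall t, 0 <= q t) -> (forall t, F t <= G t) -> expect q F <= expect q G.
Proof. by move=> q0 FG; apply: ler_sum => t _; rewrite ler_wpM2l. Qed.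

Lemma expect_sqrB {T} (q F : T -> R) a : \sum_t q t = 1 ->
  expect q (fun t => (F t - a) ^+ 2) =
  expect q (fun t => F t ^+ 2) - 2 * a * expect q F + a ^+ 2.
Proof.
move=> q1; rewrite -[in RHS](expect_cst q (a ^+ 2) q1) -mulNr -expectZ -!expectD.
by apply: eq_expect => t; ring.
Qed.

(** Markov's inequality for the squared deviation. The center [a] need not be the mean; [th] is a
    squared deviation reached at every failing point, and [v] becomes the failure probability. *)
Lemma chebyshev_finite {T} (q F : T -> R) (P : pred T) (a v th : R) :
  (forall t, 0 <= q t) -> \sum_t q t = 1 ->
  (forall t, ~~ P t -> th <= (F t - a) ^+ 2) ->
  expect q (fun t => (F t - a) ^+ 2) <= v * th -> 0 < th ->
  1 - v <= \sum_(t | P t) q t.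
Proof.
move=> q0 q1 Pth Ev th0; rewrite -q1 (bigID P) /= lerBlDr lerD2l.
rewrite -(ler_pM2r th0) (le_trans _ Ev)// mulr_suml.
apply: (@le_trans _ _ (\sum_(t | ~~ P t) q t * (F t - a) ^+ 2)).
  by apply: ler_sum => t nPt; rewrite ler_wpM2l// Pth.
rewrite /expect [leRHS](bigID P) /= lerDr.
by apply: sumr_ge0 => t _; rewrite mulr_ge0 ?sqr_ge0.
Qed.

Definition pweight {J Z} (p : J -> Z -> R) (f : {ffun J -> Z}) : R :=
  \prod_j p j (f j).

Lemma pweight_ge0 {J Z} (p : J -> Z -> R) f :
  (forall j z, 0 <= p j z) -> 0 <= pweight p f.
Proof. by move=> p0; apply: prodr_ge0. Qed.

Lemma expect_prod {J Z} (p g : J -> Z -> R) :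
  expect (pweight p) (fun f => \prod_j g j (f j)) =
  \prod_j expect (p j) (g j).
Proof.
by rewrite bigA_distr_bigA; apply: eq_bigr => f _; rewrite -big_split.
Qed.

Section ProductWeight.
Context {J Z : finType} (p : J -> Z -> R).
Hypothesis p1 : forall j, \sum_z p j z = 1.

Lemma pweight1 : \sum_f pweight p f = 1.
Proof. by rewrite -bigA_distr_bigA big1. Qed.

Lemma expect_coord j (g : Z -> R) :
  expect (pweight p) (fun f => g (f j)) = expect (p j) g.
Proof.
pose G i z := if i == j then g z else 1.
transitivity (\prod_i expect (p i) (G i)).
  rewrite -expect_prod; apply: eq_expect => f.
  by rewrite (bigD1 j) //= /G eqxx big1 ?mulr1 // => i /negPf ->.
rewrite (bigD1 j) //= big1 ?mulr1 /G ?eqxx // => i /negPf ->.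
exact: expect_cst.
Qed.

Lemma expect_coord2 i j (g h : Z -> R) : i != j ->
  expect (pweight p) (fun f => g (f i) * h (f j)) =
  expect (p i) g * expect (p j) h.
Proof.
move=> ij; have ji : j != i by rewrite eq_sym.
pose G l z := if l == i then g z else if l == j then h z else 1.
transitivity (\prod_l expect (p l) (G l)).
  rewrite -expect_prod; apply: eq_expect => f.
  rewrite (bigD1 i) //= (bigD1 j) //= /G eqxx (negPf ji) eqxx.
  by rewrite big1 ?mulr1 // => l /andP[/negPf -> /negPf ->].
rewrite (bigD1 i) //= (bigD1 j) //= big1 ?mulr1 /G ?eqxx ?(negPf ji) //.
by move=> l /andP[/negPf -> /negPf ->]; exact: expect_cst.
Qed.

(** By independence the cross terms with distinct indices factor, so only the diagonal terms leave a
    covariance. *)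
Lemma expect_sum_mul (g h : J -> Z -> R) :
  expect (pweight p) (fun f => (\sum_j g j (f j)) * (\sum_j h j (f j))) =
  (\sum_j (expect (p j) (fun z => g j z * h j z)
           - expect (p j) (g j) * expect (p j) (h j)))
  + (\sum_j expect (p j) (g j)) * (\sum_j expect (p j) (h j)).
Proof.
under eq_expect => f do rewrite mulr_suml.
rewrite expect_sum mulr_suml -big_split; apply: eq_bigr => j _ /=.
under eq_expect => f do rewrite mulr_sumr.
rewrite expect_sum (bigD1 j) //= (expect_coord j (fun z => g j z * h j z)).
under eq_bigr => i ij do rewrite expect_coord2 1?eq_sym //.
by rewrite -mulr_sumr [in RHS](bigD1 j) //=; ring.
Qed.

End ProductWeight.
End Expectation.

(* The collision statistic of two groups of samples, one sample of each group for every
   block b : B and every repetition i : M. *)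
Section Collisions.
Context {R : realFieldType} {B M Z : finType} (c : R) (p : B -> Z -> R).
Hypothesis p0 : forall b z, 0 <= p b z.
Hypothesis p1 : forall b, \sum_z p b z = 1.

Let m : R := #|M|%:R.
Let q := pweight (fun j : B * M => p j.1).

Definition centered_count (f : {ffun B * M -> Z}) (a : B * Z) : R :=
  \sum_j if j.1 == a.1 then (f j == a.2)%:R - c else 0.

(** Each group has [m] samples per block, so when [c] is the inverse of the number of outcomes this
    is the number of equal pairs, one sample from each group in the same block, minus its mean under
    uniform sampling. *)
Definition collisions (f g : {ffun B * M -> Z}) : R :=
  \sum_a centered_count f a * centered_count g a.

Let delta (a : B * Z) := p a.1 a.2 - c.
(** Covariance of two outcome indicators in a single sample; distinct blocks are independent. *)
Let cov (a a' : B * Z) : R :=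
  if a.1 == a'.1 then p a.1 a.2 * (a.2 == a'.2)%:R - p a.1 a.2 * p a'.1 a'.2
  else 0.
Let S : R := \sum_a delta a ^+ 2.

Let q1 : \sum_f q f = 1.
Proof. by apply: pweight1 => j. Qed.

Let sum_block (F : B -> R) b :
  \sum_(j : B * M) (if j.1 == b then F j.1 else 0) = m * F b.
Proof.
rewrite -big_mkcond /= (eq_bigr (fun=> F b)) => [|j /eqP -> //].
rewrite big_const iter_addr_0 -mulr_natl; congr (_%:R * _).
rewrite -(card_imset _ (fun x y : M => (fun e : (b, x) = (b, y) => congr1 snd e))).
apply: eq_card => -[b' i]; rewrite unfold_in /=; apply/eqP/imsetP => [-> | [i' _ [-> _]] //].
by exists i.
Qed.

Let expect_ind b z : expect (p b) (fun x => (x == z)%:R - c) = p b z - c.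
Proof.
rewrite expectD (expect_cst _ _ (p1 b)); congr (_ + _).
rewrite /expect (bigD1 z) //= eqxx mulr1 big1 ?addr0 // => x /negPf ->.
by rewrite mulr0.
Qed.

Let expect_if (b : bool) (P F : Z -> R) :
  expect P (fun z => if b then F z else 0) = if b then expect P F else 0.
Proof.
by case: b => //; rewrite /expect big1 // => z _; rewrite mulr0.
Qed.

Let mean_count a : expect q (fun f => centered_count f a) = m * delta a.
Proof.
rewrite expect_sum -(sum_block (fun b => p b a.2 - c)); apply: eq_bigr => j _.
rewrite (expect_coord _ _ j (fun z => if j.1 == a.1 then (z == a.2)%:R - c else 0)) //.
by rewrite expect_if expect_ind.
Qed.

Let expect_ind2 b z z' :
  expect (p b) (fun x => ((x == z)%:R - c) * ((x == z')%:R - c))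
    - (p b z - c) * (p b z' - c) = p b z * (z == z')%:R - p b z * p b z'.
Proof.
have E : expect (p b) (fun x => (x == z)%:R * (x == z')%:R) = p b z * (z == z')%:R.
  rewrite /expect (bigD1 z) //= eqxx mul1r big1 ?addr0 // => x /negPf ->.
  by rewrite mul0r mulr0.
rewrite (eq_expect _ _ (fun x => (x == z)%:R * (x == z')%:R +
  ((- c) * ((x == z)%:R - c) + ((- c) * ((x == z')%:R - c) - c ^+ 2)))); last first.
  by move=> x; ring.
by rewrite !expectD !expectZ E !expect_ind expect_cst //; ring.
Qed.

Let second_count a a' :
  expect q (fun f => centered_count f a * centered_count f a') =
  m ^+ 2 * (delta a * delta a') + m * cov a a'.
Proof.
rewrite (expect_sum_mul _ _ (fun j z => if j.1 == a.1 then (z == a.2)%:R - c else 0)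
  (fun j z => if j.1 == a'.1 then (z == a'.2)%:R - c else 0)) //.
rewrite addrC; congr (_ + _).
  have mean (x : B * Z) : \sum_(j : B * M) expect (p j.1)
      (fun z => if j.1 == x.1 then (z == x.2)%:R - c else 0) = m * delta x.
    rewrite -(sum_block (fun b => p b x.2 - c)); apply: eq_bigr => j _.
    by rewrite expect_if expect_ind.
  by rewrite !mean; ring.
rewrite /cov; have [e|ne] := eqVneq a.1 a'.1; last first.
  rewrite mulr0 big1 // => j _; rewrite !expect_if.
  have [ja|_] := eqVneq j.1 a.1.
    rewrite ja (negPf ne) mulr0 /expect big1 ?subr0 // => z _.
    by rewrite !mulr0.
  by rewrite mul0r subr0 /expect big1 // => z _; rewrite mul0r mulr0.
rewrite -e -(sum_block (fun b => p b a.2 * (a.2 == a'.2)%:R - p b a.2 * p b a'.2)).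
apply: eq_bigr => j _; have [ja|_] := eqVneq j.1 a.1.
  by rewrite !expect_ind expect_ind2.
rewrite /expect !big1 ?mulr0 ?subr0 // => z _; by rewrite !mulr0.
Qed.

Let expect2 (F : {ffun B * M -> Z} -> {ffun B * M -> Z} -> R) :=
  expect q (fun f => expect q (F f)).

Lemma mean_collisions : expect2 collisions = m ^+ 2 * S.
Proof.
rewrite /expect2 /collisions.
under eq_expect => f do rewrite expect_sum.
rewrite expect_sum mulr_sumr; apply: eq_bigr => a _.
under eq_expect => f do rewrite expectZ mean_count mulrC.
by rewrite expectZ mean_count; ring.
Qed.

(** Here the second group pays off: expanding the square gives terms that are products of one factor
    per group, and both factors have the same mean. No fourth moment of the counts is needed. *)
Let second_collisions :
  expect2 (fun f g => collisions f g ^+ 2) =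
  \sum_a \sum_a' (m ^+ 2 * (delta a * delta a') + m * cov a a') ^+ 2.
Proof.
rewrite /expect2 /collisions.
under eq_expect => f.
  under eq_expect => g.
    rewrite expr2 mulr_suml.
    under eq_bigr => a _ do rewrite mulr_sumr.
    over.
  rewrite expect_sum; under eq_bigr => a _ do rewrite expect_sum.
  over.
rewrite expect_sum; apply: eq_bigr => a _.
rewrite expect_sum; apply: eq_bigr => a' _.
under eq_expect => f.
  rewrite (eq_expect _ _ (fun g => centered_count f a * centered_count f a' *
    (centered_count g a * centered_count g a'))); last by move=> g; ring.
  rewrite expectZ second_count mulrC.
  over.
by rewrite expectZ second_count expr2.
Qed.

Let sum_cov F : \sum_a \sum_a' F a a' * cov a a' =
  \sum_b \sum_z \sum_z' F (b, z) (b, z') *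
    (p b z * (z == z')%:R - p b z * p b z').
Proof.
rewrite sum_pairE.
apply: eq_bigr => b _; apply: eq_bigr => z _.
rewrite sum_pairE.
rewrite (bigD1 b) //= [X in _ + X]big1 ?addr0 /cov /= ?eqxx // => b' nb.
by rewrite big1 // => z' _; rewrite eq_sym (negPf nb) mulr0.
Qed.

Let sum_diag (F : Z -> Z -> R) : \sum_z \sum_z' F z z' * (z == z')%:R = \sum_z F z z.
Proof.
apply: eq_bigr => z _; rewrite (bigD1 z) //= eqxx mulr1 big1 ?addr0 // => z'.
by rewrite eq_sym => /negPf ->; rewrite mulr0.
Qed.

(** Within a block the left side is a weighted second moment minus the square of a mean; the square
    is dropped. *)
Let cov_delta : \sum_a \sum_a' (delta a * delta a') * cov a a' <=
  \sum_a p a.1 a.2 * delta a ^+ 2.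
Proof.
rewrite sum_cov sum_pairE.
apply: ler_sum => b _.
pose u z := p b z * delta (b, z).
rewrite (_ : \sum_z _ = \sum_z p b z * delta (b, z) ^+ 2 - (\sum_z u z) ^+ 2).
  by rewrite lerBlDr lerDl sqr_ge0.
rewrite -(sum_diag (fun z z' => p b z * (delta (b, z) * delta (b, z')))).
rewrite expr2 mulr_suml -sumrB; apply: eq_bigr => z _.
rewrite mulr_sumr -sumrB; apply: eq_bigr => z' _.
by rewrite /u; ring.
Qed.

Let cov_sqr : \sum_a \sum_a' cov a a' ^+ 2 <= 2 * \sum_a p a.1 a.2 ^+ 2.
Proof.
under eq_bigr => a _ do under eq_bigr => a' _ do rewrite expr2.
rewrite sum_cov sum_pairE /= mulr_sumr.
apply: ler_sum => b _.
have le1 : \sum_z p b z ^+ 2 <= 1.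
  rewrite -(p1 b); apply: ler_sum => z _.
  by rewrite ler_piMr // -(p1 b) (bigD1 z) //= lerDl sumr_ge0.
pose N := \sum_z p b z ^+ 2.
(* For outcomes of probabilities x and y the squared covariance is at most x y [same outcome] + x^2
   y^2. These bounds sum to N + N^2, and N <= 1. *)
apply: (@le_trans _ _ (N + N ^+ 2)); last first.
  rewrite mulr_natl mulr2n lerD2l expr2 ler_piMl // sumr_ge0 // => z _.
  exact: sqr_ge0.
have D : \sum_z \sum_z' p b z * p b z' * (z == z')%:R = N.
  by rewrite (sum_diag (fun z z' => p b z * p b z')).
rewrite -[X in X + _]D expr2 mulr_suml -big_split /=.
apply: ler_sum => z _; rewrite mulr_sumr -big_split /=.
apply: ler_sum => z' _; rewrite /cov /= eqxx.
have := p0 b z; have := p0 b z'; have [->|_] := eqVneq z z' => /= h1 h2; nra.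
Qed.

(** The part of order m^4 in the second moment is the squared mean and cancels. The m^2 term is the
    noise of the counts, present even under uniform sampling; the m^3 term is the interference of
    noise and signal. *)
Lemma var_collisions :
  expect2 (fun f g => (collisions f g - m ^+ 2 * S) ^+ 2) <=
  2 * m ^+ 2 * (\sum_a p a.1 a.2 ^+ 2) +
  2 * m ^+ 3 * (\sum_a p a.1 a.2 * (p a.1 a.2 - c) ^+ 2).
Proof.
have -> : expect2 (fun f g => (collisions f g - m ^+ 2 * S) ^+ 2) =
    expect2 (fun f g => collisions f g ^+ 2) - (m ^+ 2 * S) ^+ 2.
  transitivity (expect2 (fun f g => collisions f g ^+ 2) +
      (- (2 * (m ^+ 2 * S)) * expect2 collisions + (m ^+ 2 * S) ^+ 2)).
    rewrite /expect2 -(expectZ q) -[X in _ + (_ + X)](expect_cst q _ q1) -!expectD.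
    by apply: eq_expect => f; rewrite expect_sqrB //; ring.
  by rewrite mean_collisions; ring.
have m0 : 0 <= m by rewrite ler0n.
rewrite second_collisions.
rewrite (_ : \sum_a _ = (m ^+ 2 * S) ^+ 2 + (m ^+ 2 * (\sum_a \sum_a' cov a a' ^+ 2) +
   2 * m ^+ 3 * (\sum_a \sum_a' (delta a * delta a') * cov a a'))).
  rewrite addrAC subrr add0r lerD //.
    have := ler_wpM2l (exprn_ge0 2 m0) cov_sqr; lra.
  by rewrite ler_wpM2l ?mulr_ge0 ?exprn_ge0 // cov_delta.
rewrite exprMn [S ^+ 2]expr2 [in S * _]mulr_suml.
rewrite !mulr_sumr -!big_split; apply: eq_bigr => a _.
rewrite !mulr_sumr -!big_split; apply: eq_bigr => a' _ /=.
ring.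
Qed.

End Collisions.

(** * Hypercontractivity for polynomials in random signs *)

Section Hypercontractivity.

(* A polynomial of degree at most d in the n signs (-1) ^+ b of the bits b of the argument. *)
Fixpoint poly_signs {A : comPzRingType} (n d : nat) (f : seq bool -> A) : Prop :=
  if n isn't n'.+1 then True else
  exists g h : seq bool -> A,
    [/\ poly_signs n' d g, poly_signs n' d.-1 h, d = 0%N -> h = fun=> 0
      & forall b s, f (b :: s) = g s + (-1) ^+ b * h s].

Section Closure.
Context {A : comPzRingType}.
Implicit Types f g : seq bool -> A.

Lemma poly_signs_ext n d f g : f =1 g -> poly_signs n d f -> poly_signs n d g.
Proof. by move=> /funext ->. Qed.

Lemma poly_signs_cst n d (a : A) : poly_signs n d (fun=> a).
Proof.
elim: n d a => [|n IH] d a //=; exists (fun=> a), (fun=> 0); split=> // b s.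
by rewrite mulr0 addr0.
Qed.

Lemma poly_signs_le n d e f : (d <= e)%N -> poly_signs n d f -> poly_signs n e f.
Proof.
elim: n d e f => [|n IH] d e f de //= [g [h [pg ph h0 E]]].
exists g, h; split=> //; first exact: IH pg.
  by apply: IH ph; rewrite -!subn1 leq_sub2r.
by move=> e0; apply: h0; apply/eqP; rewrite -leqn0 -e0.
Qed.

Lemma poly_signsD n d f g : poly_signs n d f -> poly_signs n d g ->
  poly_signs n d (fun s => f s + g s).
Proof.
elim: n d f g => [|n IH] d f g //= [f0 [f1 [pf0 pf1 f10 Ef]]] [g0 [g1 [pg0 pg1 g10 Eg]]].
exists (fun s => f0 s + g0 s), (fun s => f1 s + g1 s); split.
- exact: IH.
- exact: IH.
- by move=> d0; rewrite f10 // g10 //; apply/funext => s; rewrite addr0.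
- by move=> b s; rewrite Ef Eg; ring.
Qed.

(** Signs square to 1, so the product of the two linear parts moves into the constant part. Degree 0
    is treated apart because the predecessor is truncated there: the linear part vanishes instead of
    losing a degree. *)
Lemma poly_signsM n d e f g : poly_signs n d f -> poly_signs n e g ->
  poly_signs n (d + e) (fun s => f s * g s).
Proof.
elim: n d e f g => [|n IH] d e f g //= [f0 [f1 [pf0 pf1 f10 Ef]]] [g0 [g1 [pg0 pg1 g10 Eg]]].
exists (fun s => f0 s * g0 s + f1 s * g1 s), (fun s => f0 s * g1 s + f1 s * g0 s).
split.
- apply: poly_signsD; first exact: IH.
  by apply: poly_signs_le (IH _ _ _ _ pf1 pg1); rewrite leq_add ?leq_pred.
- apply: poly_signsD.
    case: e pg1 g10 {pg0} => [_ ->|e pg1 _] //.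
      by apply: poly_signs_ext (poly_signs_cst _ _ 0) => s; rewrite mulr0.
    by rewrite addnS; exact: IH.
  case: d pf1 f10 {pf0} => [_ ->|d pf1 _] //.
    by apply: poly_signs_ext (poly_signs_cst _ _ 0) => s; rewrite mul0r.
  exact: IH.
- move/eqP; rewrite addn_eq0 => /andP[/eqP d0 /eqP e0].
  by rewrite f10 // g10 //; apply/funext => s; rewrite mulr0 mul0r addr0.
- move=> b s; rewrite Ef Eg; case: b; rewrite ?expr0 ?expr1; ring.
Qed.

Lemma poly_signsZ n d (a : A) f : poly_signs n d f -> poly_signs n d (fun s => a * f s).
Proof. by move=> pf; exact: (poly_signsM _ 0 d _ _ (poly_signs_cst _ _ _) pf). Qed.

Lemma poly_signs_sum n d (I : finType) (f : I -> seq bool -> A) :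
  (forall i, poly_signs n d (f i)) -> poly_signs n d (fun s => \sum_i f i s).
Proof.
move=> pf; elim: (index_enum I) => [|i r IH].
  by apply: poly_signs_ext (poly_signs_cst _ _ 0) => s; rewrite big_nil.
by apply: poly_signs_ext (poly_signsD _ _ _ _ (pf i) IH) => s; rewrite big_cons.
Qed.

Lemma poly_signs_sign n i : poly_signs n 1 (fun s => (-1) ^+ nth false s i : A).
Proof.
elim: n i => [|n IH] [|i] //=.
  exists (fun=> 0), (fun=> 1); split=> //; try exact: poly_signs_cst.
  by move=> b s; rewrite add0r mulr1.
exists (fun s => (-1) ^+ nth false s i), (fun=> 0); split=> //.
  exact: poly_signs_cst.
by move=> b s; rewrite mulr0 addr0.
Qed.

End Closure.

Context {R : realFieldType}.

Fixpoint mean_bits (n : nat) (f : seq bool -> R) : R :=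
  if n isn't n'.+1 then f [::] else
  (mean_bits n' (fun s => f (true :: s)) + mean_bits n' (fun s => f (false :: s))) / 2.

Lemma mean_bitsD n f g :
  mean_bits n (fun s => f s + g s) = mean_bits n f + mean_bits n g.
Proof. by elim: n f g => [|n IH] f g //=; rewrite !IH; field. Qed.

Lemma mean_bitsZ n a f : mean_bits n (fun s => a * f s) = a * mean_bits n f.
Proof. by elim: n f => [|n IH] f //=; rewrite !IH; field. Qed.

Lemma ler_mean_bits n f g : (forall s, f s <= g s) -> mean_bits n f <= mean_bits n g.
Proof.
elim: n f g => [|n IH] f g fg //=; rewrite ler_pM2r ?invr_gt0 ?ltr0n //.
by rewrite lerD // IH.
Qed.

Lemma mean_bits_ge0 n f : (forall s, 0 <= f s) -> 0 <= mean_bits n f.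
Proof.
by elim: n f => [|n IH] f f0 //=; rewrite divr_ge0 ?ler0n // addr_ge0 ?IH.
Qed.

Lemma eq_mean_bits n f g : f =1 g -> mean_bits n f = mean_bits n g.
Proof. by move=> /funext ->. Qed.

Lemma mean_bits0 n f : (forall s, f s = 0) -> mean_bits n f = 0.
Proof. by elim: n f => [|n IH] f f0 //=; rewrite !IH ?addr0 ?mul0r. Qed.

(* Bonami's lemma in polarized form; the polarization makes the induction free of
   square roots. *)
Lemma mean_bits_sqr_mul n d e (f g : seq bool -> R) :
  poly_signs n d f -> poly_signs n e g ->
  mean_bits n (fun s => f s ^+ 2 * g s ^+ 2) <=
  3 ^+ (d + e) * (mean_bits n (fun s => f s ^+ 2) * mean_bits n (fun s => g s ^+ 2)).
Proof.
elim: n d e f g => [|n IH] d e f g /=.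
  by move=> _ _; rewrite ler_peMl ?exprn_ege1 ?ler1n // -exprMn sqr_ge0.
move=> [f0 [f1 [pf0 pf1 f10 Ef]]] [g0 [g1 [pg0 pg1 g10 Eg]]].
pose Q (f g : seq bool -> R) := mean_bits n (fun s => f s ^+ 2 * g s ^+ 2).
pose N (f : seq bool -> R) := mean_bits n (fun s => f s ^+ 2).
have N0 f2 : 0 <= N f2 by apply: mean_bits_ge0 => s; exact: sqr_ge0.
have NE (F F0 F1 : seq bool -> R) :
    (forall b s, F (b :: s) = F0 s + (-1) ^+ b * F1 s) ->
    (mean_bits n (fun s => F (true :: s) ^+ 2)
     + mean_bits n (fun s => F (false :: s) ^+ 2)) / 2 = N F0 + N F1.
  move=> EF; rewrite /N -!mean_bitsD mulrC -mean_bitsZ.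
  by apply: eq_mean_bits => s; rewrite !EF; field.
rewrite (NE _ _ _ Ef) (NE _ _ _ Eg) -mean_bitsD mulrC -mean_bitsZ.
have zero : N (fun=> 0) = 0.
  by apply: mean_bits0 => s; rewrite expr0n.
have Q0l F : Q (fun=> 0) F = 0.
  by apply: mean_bits0 => s; rewrite expr0n mul0r.
have Q0r F : Q F (fun=> 0) = 0.
  by apply: mean_bits0 => s; rewrite expr0n mulr0.
have h00 : Q f0 g0 <= 3 ^+ (d + e) * (N f0 * N g0) by exact: IH.
have h01 : 3 * Q f0 g1 <= 3 ^+ (d + e) * (N f0 * N g1).
  case: e pg1 g10 {pg0 h00} => [_ ->|e pg1 _] //; first by rewrite Q0r zero !mulr0.
  by rewrite addnS exprS -mulrA ler_pM2l ?ltr0n //; exact: IH.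
have h10 : 3 * Q f1 g0 <= 3 ^+ (d + e) * (N f1 * N g0).
  case: d pf1 f10 {pf0 h00 h01} => [_ ->|d pf1 _] //; first by rewrite Q0l zero mul0r !mulr0.
  by rewrite addSn exprS -mulrA ler_pM2l ?ltr0n //; exact: IH.
have h11 : Q f1 g1 <= 3 ^+ (d + e) * (N f1 * N g1).
  apply: le_trans (IH _ _ _ _ pf1 pg1) _; apply: ler_wpM2r; first exact: mulr_ge0 (N0 _) (N0 _).
  by apply: ler_weXn2l; rewrite ?ler1n // leq_add ?leq_pred.
(* Averaging over the first sign leaves the cross term 4 f0 f1 g0 g1, at most 2 f0^2 g1^2 + 2 f1^2
   g0^2. This produces the two factors 3, which the drop of degree in [h01] and [h10] pays for. *)
apply: (@le_trans _ _ (Q f0 g0 + 3 * Q f0 g1 + 3 * Q f1 g0 + Q f1 g1)); last by lra.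
rewrite /Q -!mean_bitsZ -!mean_bitsD; apply: ler_mean_bits => s.
rewrite !Ef !Eg expr0 expr1.
have := sqr_ge0 (f0 s * g1 s - f1 s * g0 s); nra.
Qed.

Lemma mean_bits_sum n (I : finType) (f : I -> seq bool -> R) :
  mean_bits n (fun s => \sum_i f i s) = \sum_i mean_bits n (f i).
Proof.
elim: (index_enum I) => [|i r IH].
  by rewrite big_nil mean_bits0 // => s; rewrite big_nil.
by rewrite big_cons -IH -mean_bitsD; apply: eq_mean_bits => s; rewrite big_cons.
Qed.

Lemma mean_bits_tuple n (f : seq bool -> R) :
  \sum_(t : n.-tuple bool) f t = 2 ^+ n * mean_bits n f.
Proof.
elim: n f => [|n IH] f /=.
  by rewrite expr0 mul1r (big_pred1 [tuple]) // => t; rewrite /= [t]tuple0; apply/esym/eqP.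
rewrite (reindex (fun p : bool * n.-tuple bool => [tuple of p.1 :: p.2])) /=.
  rewrite -(pair_bigA _ (fun b (t : n.-tuple bool) => f (b :: t))) /= big_bool /=.
  by rewrite (IH (fun s => f (true :: s))) (IH (fun s => f (false :: s))) exprS; field.
exists (fun t => (thead t, [tuple of behead t])) => [[b t] _ | t _] /=.
  by congr (_, _); apply: val_inj.
by rewrite [RHS]tuple_eta; apply: val_inj.
Qed.

Definition unif {T : finType} : T -> R := fun=> #|T|%:R^-1.

Lemma unif_ge0 {T : finType} (t : T) : 0 <= unif t.
Proof. by rewrite invr_ge0. Qed.

Lemma unif1 {T : finType} (t : T) : \sum_(x : T) unif x = 1.
Proof.
rewrite big_const iter_addr_0 -[X in X *+ _]mul1r -mulrnAr -mulr_natl mul1r mulfV //.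
by rewrite pnatr_eq0 -lt0n; apply/card_gt0P; exists t.
Qed.

End Hypercontractivity.

Section BitFunctions.
Context {I : finType}.

(** Transports the list induction behind [poly_signs] and [mean_bits] to bits indexed by any finite
    type. *)
Definition bits_of_seq (s : seq bool) : {ffun I -> bool} :=
  [ffun i => nth false s (enum_rank i)].

Definition poly_bits {A : comPzRingType} (d : nat) (F : {ffun I -> bool} -> A) :=
  poly_signs #|I| d (fun s => F (bits_of_seq s)).

Lemma poly_bits_sign {A : comPzRingType} i :
  poly_bits 1 (fun w : {ffun I -> bool} => (-1) ^+ w i : A).
Proof.
apply: poly_signs_ext (poly_signs_sign #|I| (enum_rank i)) => s.
by rewrite ffunE.
Qed.

Context {R : realFieldType}.

Lemma expect_bits (F : {ffun I -> bool} -> R) :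
  expect unif F = mean_bits #|I| (fun s => F (bits_of_seq s)).
Proof.
rewrite /expect /unif -mulr_sumr card_ffun card_bool natrX.
rewrite (reindex (fun t : #|I|.-tuple bool => bits_of_seq t)) /=.
  by rewrite (mean_bits_tuple _ (fun s => F (bits_of_seq s))) mulKf // expf_neq0 // pnatr_eq0.
exists (fun w : {ffun I -> bool} => [tuple w (enum_val i) | i < #|I|]) => [t _|w _].
  by apply: eq_from_tnth => i; rewrite tnth_mktuple ffunE enum_valK -tnth_nth.
by apply/ffunP => i; rewrite ffunE -tnth_nth tnth_mktuple enum_rankK.
Qed.

(** Bonami's lemma is applied to each product of two squares in the expansion. Its right side
    factors, so the sum reassembles into a square and the number of polynomials does not enter the
    constant. *)
Lemma hypercontractivity {J : finType} d (F : J -> {ffun I -> bool} -> R) :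
  (forall j, poly_bits d (F j)) ->
  expect unif (fun w => (\sum_j F j w ^+ 2) ^+ 2) <=
  9 ^+ d * expect unif (fun w => \sum_j F j w ^+ 2) ^+ 2.
Proof.
move=> pF; rewrite !expect_bits.
rewrite (eq_mean_bits _ _ (fun s => \sum_j \sum_i
  F j (bits_of_seq s) ^+ 2 * F i (bits_of_seq s) ^+ 2)); last first.
  by move=> s; rewrite expr2 mulr_suml; under eq_bigr => i _ do rewrite mulr_sumr.
rewrite !mean_bits_sum expr2 mulr_suml mulr_sumr; apply: ler_sum => j _.
rewrite mean_bits_sum !mulr_sumr; apply: ler_sum => i _.
apply: le_trans (mean_bits_sqr_mul _ _ _ _ _ (pF j) (pF i)) _.
have -> : 9 ^+ d = 3 ^+ (d + d) :> R by rewrite exprD -exprMn; congr (_ ^+ _); ring.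
by rewrite mulrA.
Qed.

End BitFunctions.

(** * Second moments of random phases *)

Section ComplexParts.
Context {R : realType}.
Local Notation C := R[i].
Local Notation Re := (@complex.Re R).
Local Notation Im := (@complex.Im R).

Lemma ReD (x y : C) : Re (x + y) = Re x + Re y.
Proof. by case: x; case: y. Qed.

Lemma ReN (x : C) : Re (- x) = - Re x.
Proof. by case: x. Qed.

Lemma ImD (x y : C) : Im (x + y) = Im x + Im y.
Proof. by case: x; case: y. Qed.

Lemma ImN (x : C) : Im (- x) = - Im x.
Proof. by case: x. Qed.

Lemma Re_sum {I : Type} (r : seq I) (P : pred I) (F : I -> C) :
  Re (\sum_(i <- r | P i) F i) = \sum_(i <- r | P i) Re (F i).
Proof. exact: (big_morph Re ReD erefl). Qed.

Lemma Re_realM (r : R) (x : C) : Re (r%:C%C * x) = r * Re x.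
Proof. by case: x => a b; rewrite /= mul0r subr0. Qed.

Lemma Im_realM (r : R) (x : C) : Im (r%:C%C * x) = r * Im x.
Proof. by case: x => a b; rewrite /= mul0r addr0. Qed.

Definition normc2 (z : C) : R := Re z ^+ 2 + Im z ^+ 2.

Lemma normc2E z : (normc2 z)%:C%C = z * z^*.
Proof. by rewrite add_Re2_Im2 normCK. Qed.

Lemma normc2_ge0 z : 0 <= normc2 z.
Proof. by rewrite addr_ge0 ?sqr_ge0. Qed.

Lemma normc2M x y : normc2 (x * y) = normc2 x * normc2 y.
Proof. by case: x => a b; case: y => c d; rewrite /normc2 /=; ring. Qed.

Lemma normc2_real (r : R) : normc2 r%:C%C = r ^+ 2.
Proof. by rewrite /normc2 /= expr0n addr0. Qed.

Lemma normc2_conj z : normc2 z^* = normc2 z.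
Proof. by apply: complexI; rewrite !normc2E conjCK mulrC. Qed.

Lemma Re_sqr_normc2 (z : C) : z^* = z -> Re z ^+ 2 = normc2 z.
Proof. by case: z => a b [/eqP]; rewrite -subr_eq0 -opprD oppr_eq0 -mulr2n mulrn_eq0 /= /normc2 /= => /eqP ->; rewrite expr0n addr0. Qed.

Lemma Re_ge0 (z : C) : 0 <= z -> 0 <= Re z.
Proof. by case: z => a b; rewrite lecE /= => /andP[]. Qed.

End ComplexParts.

Section Orthogonality.
Context {R : realType}.
Local Notation C := R[i].

(** Parseval's identity for an orthogonal family with squared norms [v]. A zero norm is allowed, so
    an index may carry the zero function. *)
Lemma sum_normc2_orthogonal {W T : finType} (chi : T -> W -> C) (v : T -> R) (a : T -> C) :
  (forall s t, \sum_w chi s w * (chi t w)^* = if s == t then (#|W|%:R * v s)%:C%C else 0) ->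
  (0 < #|W|)%N ->
  expect unif (fun w => normc2 (\sum_t a t * chi t w)) = \sum_t v t * normc2 (a t).
Proof.
move=> orth W0; have W1 : #|W|%:R != 0 :> R by rewrite pnatr_eq0 -lt0n.
rewrite /expect /unif -mulr_sumr; apply/(mulfI W1); rewrite mulVKf //.
apply: complexI; rewrite rmorph_sum mulr_sumr rmorph_sum /=.
under eq_bigr => w _.
  rewrite normc2E rmorph_sum mulr_suml; under eq_bigr => s _ do rewrite mulr_sumr.
  over.
rewrite exchange_big; apply: eq_bigr => s _ /=.
rewrite exchange_big (bigD1 s) //= [X in _ + X]big1 ?addr0 => [|t ts].
  under eq_bigr => w _ do rewrite rmorphM mulrACA.
  by rewrite -mulr_sumr orth eqxx -normc2E -rmorphM; congr _%:C%C; ring.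
under eq_bigr => w _ do rewrite rmorphM mulrACA.
by rewrite -mulr_sumr orth eq_sym (negPf ts) mulr0.
Qed.

(** Reindexing the sum by [f] multiplies it by [k]. *)
Lemma sum_eigenvector0 {W : finType} (f : W -> W) (g : W -> C) (k : C) :
  injective f -> (forall w, g (f w) = k * g w) -> k != 1 -> \sum_w g w = 0.
Proof.
move=> f_inj fE k1; have : (k - 1) * (\sum_w g w) = 0.
  rewrite mulrBl mul1r {2}(reindex_inj f_inj) mulr_sumr.
  by under [in X in _ - X]eq_bigr => w _ do rewrite fE; rewrite subrr.
by move/eqP; rewrite mulf_eq0 subr_eq0 (negPf k1) => /eqP.
Qed.

End Orthogonality.

Section Phases.
Context {R : realType} {I : finType}.
Local Notation C := R[i].
Implicit Types (w : {ffun I * bool -> bool}) (i j p : I).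

Definition sign_bit w i : C := (-1) ^+ w (i, false).
(** Four equally spaced values of squared modulus 2, written with two independent signs so that a
    phase is a polynomial of degree 1 in the bits. *)
Definition phase w i : C := sign_bit w i + 'i * (-1) ^+ w (i, true).

Lemma sign_bit_conj w i : (sign_bit w i)^* = sign_bit w i.
Proof. by rewrite /sign_bit rmorphXn rmorphN rmorph1. Qed.

Lemma sign_bit_sqr w i : sign_bit w i * sign_bit w i = 1.
Proof. by rewrite /sign_bit -signr_addb addbb. Qed.

Lemma phase_norm w i : phase w i * (phase w i)^* = 2.
Proof.
rewrite /phase rmorphD rmorphM /= sign_bit_conj conjCi rmorphXn rmorphN rmorph1.
rewrite mulrDl !mulrDr sign_bit_sqr.
set s := sign_bit w i; set t := _ ^+ w _.
have -> : 'i * t * (- 'i * t) = - ('i ^+ 2) * (t * t) by ring.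
by rewrite sqrCi /t -signr_addb addbb expr0; ring.
Qed.

(* Multiplies the phase of index p by 'i and fixes the others. *)
Definition rotate p w : {ffun I * bool -> bool} :=
  [ffun x => if x.1 == p then if x.2 then w (p, false) else ~~ w (p, true) else w x].

Lemma rotate_inj p : injective (rotate p).
Proof.
move=> w w' E; apply/ffunP => -[j b]; have [->|jp] := eqVneq j p.
  by case: b; move/ffunP: (E) => /(_ (p, false)) /=; move/ffunP: E => /(_ (p, true)) /=;
     rewrite !ffunE /= eqxx // => _ /negb_inj.
by move/ffunP: E => /(_ (j, b)); rewrite !ffunE /= (negPf jp).
Qed.

Lemma phase_rotate p w i : phase (rotate p w) i = (if i == p then 'i else 1) * phase w i.
Proof.
rewrite /phase /sign_bit !ffunE /=; have [->|_] := eqVneq i p; last by rewrite mul1r.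
by rewrite signrN mulrDr mulrA -expr2 sqrCi mulN1r addrC.
Qed.

(** One rotation exchanges the two bits of an index, so a sign bit is an eigenvector only of the
    double rotation, which negates it. *)
Lemma sign_bit_rotate2 p w i :
  sign_bit (rotate p (rotate p w)) i = (-1) ^+ (i == p) * sign_bit w i.
Proof.
rewrite /sign_bit !ffunE /=; have [->|_] := eqVneq i p; last by rewrite mul1r.
by rewrite /= eqxx signrN expr1 mulN1r.
Qed.

Lemma conjCi_neq1 : ('i : C)^* != 1.
Proof. by rewrite conjCi -complexiE eq_complex /= oppr_eq0 oner_eq0 andbF. Qed.

Lemma imaginary_neq1 : ('i : C) != 1.
Proof. by rewrite -complexiE eq_complex /= oner_eq0 andbF. Qed.

Lemma N1_neq1 : (-1 : C) != 1.
Proof. by rewrite -subr_eq0 -opprD oppr_eq0 -mulr2n pnatr_eq0. Qed.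

(** The products with i = j all equal 2 and add up coherently, while those with i != j have squared
    norm 4 and are orthogonal to each other and to the constants. In [chi] the index [None] carries
    the constant and the diagonal pairs carry zero. *)
Lemma mean_phases_sqr (a : I -> I -> C) :
  expect unif (fun w => normc2 (\sum_i \sum_j a i j * (phase w i * (phase w j)^*))) =
  4 * normc2 (\sum_i a i i) + 4 * \sum_i \sum_(j | j != i) normc2 (a i j).
Proof.
pose chi (t : option (I * I)) w : C :=
  if t is Some ij then if ij.1 == ij.2 then 0 else phase w ij.1 * (phase w ij.2)^* else 1.
pose v (t : option (I * I)) : R :=
  if t is Some ij then if ij.1 == ij.2 then 0 else 4 else 1.
pose b (t : option (I * I)) : C :=
  if t is Some ij then a ij.1 ij.2 else 2 * \sum_i a i i.
have sum_opt (V : nmodType) (F : option (I * I) -> V) :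
    \sum_t F t = F None + \sum_i \sum_j F (Some (i, j)).
  rewrite (bigD1 None) //= (reindex_omap Some id) /=; last by case.
  rewrite pair_bigA; congr (_ + _).
  by apply: eq_big => [x|[]] //; rewrite eqxx.
have orth s t : \sum_w chi s w * (chi t w)^* =
    if s == t then (#|{ffun I * bool -> bool}|%:R * v s)%:C%C else 0.
  rewrite /v; case: s t => [[i j]|] [[k l]|] /=; last 1 first.
  - rewrite mulr1 rmorph_nat (eq_bigr (fun=> 1)) ?sumr_const // => w _.
    by rewrite rmorph1 mulr1.
  - rewrite (_ : Some (i, j) == Some (k, l) = (i == k) && (j == l)) //.
    have [ij|ij] := eqVneq i j.
      rewrite mulr0 if_same big1 // => w _; rewrite /= ?mul0r //.
    have [kl|kl] := eqVneq k l.
      rewrite big1 => [|w _]; last by rewrite rmorph0 mulr0.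
      by case: ifP => // /andP[/eqP ik /eqP jl]; rewrite ik jl kl eqxx in ij.
    have [ik|ik] := eqVneq i k; last first.
      (* The case [l = i] contains the swapped pair (j, i). Its eigenvalue is the square of the
         imaginary unit, -1; with phases 1 and -1 only it would be 1 and orthogonality would
         fail. *)
      rewrite /=; apply: (sum_eigenvector0 (rotate i) _ ('i * (if l == i then 'i else 1))).
      - exact: rotate_inj.
      - move=> w; rewrite !phase_rotate eqxx (eq_sym j) (negPf ij) (eq_sym k) (negPf ik).
        by rewrite !rmorphM /= !conjCK rmorph1; ring.
      - by case: ifP; rewrite ?mulr1 ?imaginary_neq1 // -expr2 sqrCi N1_neq1.
    have [jl|jl] /= := eqVneq j l.
      subst k l; rewrite (eq_bigr (fun=> 4)) => [|w _].
        by rewrite sumr_const rmorphM !rmorph_nat [RHS]mulr_natl.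
      rewrite rmorphM /= conjCK (_ : 4 = 2 * 2); last by rewrite -natrM.
      by rewrite -{1}(phase_norm w i) -(phase_norm w j); ring.
    apply: (sum_eigenvector0 (rotate j) _ ('i)^*).
    - exact: rotate_inj.
    - move=> w; rewrite !phase_rotate eqxx -ik (negPf ij) (eq_sym l) (negPf jl).
      by rewrite !rmorphM /= !conjCK rmorph1; ring.
    - exact: conjCi_neq1.
  - have [ij|ij] := eqVneq i j; first by rewrite big1 // => w _; rewrite mul0r.
    apply: (sum_eigenvector0 (rotate i) _ 'i).
    - exact: rotate_inj.
    - move=> w; rewrite !phase_rotate eqxx (eq_sym j) (negPf ij).
      by rewrite !rmorphM /= !rmorph1; ring.
    - exact: imaginary_neq1.
  - have [kl|kl] := eqVneq k l; first by rewrite big1 // => w _; rewrite rmorph0 mulr0.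
    apply: (sum_eigenvector0 (rotate l) _ 'i).
    - exact: rotate_inj.
    - move=> w; rewrite !phase_rotate eqxx (negPf kl).
      by rewrite !rmorphM /= !conjCK !rmorph1; ring.
    - exact: imaginary_neq1.
have W0 : (0 < #|{ffun I * bool -> bool}|)%N.
  by apply/card_gt0P; exists [ffun=> true].
transitivity (expect unif (fun w => normc2 (\sum_t b t * chi t w))).
  apply: eq_expect => w; rewrite sum_opt /= mulr1 mulr_sumr -big_split.
  congr normc2; apply: eq_bigr => i _ /=.
  rewrite (bigD1 i) //= phase_norm mulrC [in RHS](bigD1 i) //= eqxx mulr0 add0r.
  by congr (_ + _); apply: eq_bigr => j ji; rewrite eq_sym (negPf ji).
rewrite (sum_normc2_orthogonal chi v b orth W0) sum_opt /= mul1r normc2M.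
rewrite (_ : normc2 2 = 4); last by rewrite -(rmorph_nat (real_complex R)) normc2_real; ring.
congr (_ + _); rewrite mulr_sumr; apply: eq_bigr => i _.
rewrite mulr_sumr (bigD1 i) //= eqxx mul0r add0r.
by apply: eq_bigr => j ji; rewrite eq_sym (negPf ji).
Qed.

Lemma mean_signs_sqr (a0 : C) (a : I -> C) :
  expect unif (fun w => normc2 (a0 + \sum_i a i * sign_bit w i)) =
  normc2 a0 + \sum_i normc2 (a i).
Proof.
pose chi (t : option I) w : C := if t is Some i then sign_bit w i else 1.
pose b (t : option I) : C := if t is Some i then a i else a0.
have sum_opt (V : nmodType) (F : option I -> V) :
    \sum_t F t = F None + \sum_i F (Some i).
  rewrite (bigD1 None) //= (reindex_omap Some id) /=; last by case.
  by congr (_ + _); apply: eq_bigl => x; rewrite eqxx.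
have W0 : (0 < #|{ffun I * bool -> bool}|)%N.
  by apply/card_gt0P; exists [ffun=> true].
have vanish i (g : {ffun I * bool -> bool} -> C) :
    (forall w, g (rotate i (rotate i w)) = - g w) -> \sum_w g w = 0.
  move=> gE; apply: (sum_eigenvector0 (rotate i \o rotate i) _ (-1)).
  - exact: inj_comp (rotate_inj i) (rotate_inj i).
  - by move=> w /=; rewrite gE mulN1r.
  - exact: N1_neq1.
have orth s t : \sum_w chi s w * (chi t w)^* =
    if s == t then (#|{ffun I * bool -> bool}|%:R * 1)%:C%C else 0.
  rewrite mulr1 rmorph_nat; case: s t => [i|] [j|] /=.
  - rewrite (_ : (Some i == Some j) = (i == j)) //; have [->|ij] := eqVneq i j.
      rewrite (eq_bigr (fun=> 1)) ?sumr_const // => w _.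
      by rewrite sign_bit_conj sign_bit_sqr.
    apply: (vanish i) => w; rewrite !sign_bit_conj !sign_bit_rotate2 eqxx.
    by rewrite (eq_sym j) (negPf ij) expr1 expr0; ring.
  - apply: (vanish i) => w; rewrite !rmorph1 !sign_bit_rotate2 eqxx expr1; ring.
  - apply: (vanish j) => w; rewrite !sign_bit_conj !sign_bit_rotate2 eqxx expr1; ring.
  - rewrite (eq_bigr (fun=> 1)) ?sumr_const // => w _; by rewrite rmorph1 mulr1.
transitivity (expect unif (fun w => normc2 (\sum_t b t * chi t w))).
  by apply: eq_expect => w; rewrite sum_opt /= mulr1.
rewrite (sum_normc2_orthogonal chi (fun=> 1) b orth W0) sum_opt mul1r.
by congr (_ + _); apply: eq_bigr => i _; rewrite mul1r.
Qed.

Lemma poly_bits_phase i : poly_bits 1 (fun w => phase w i).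
Proof.
apply: poly_signsD; first exact: poly_bits_sign.
exact: (poly_signsZ _ _ _ _ (poly_bits_sign _)).
Qed.

Lemma poly_bits_phase_conj i : poly_bits 1 (fun w => (phase w i)^*).
Proof.
apply: (@poly_signs_ext _ _ _ (fun s => sign_bit (bits_of_seq s) i
   + (- 'i) * (-1) ^+ bits_of_seq s (i, true))) => [s|].
  by rewrite rmorphD rmorphM /= sign_bit_conj conjCi rmorphXn rmorphN rmorph1.
apply: poly_signsD; first exact: poly_bits_sign.
exact: (poly_signsZ _ _ _ _ (poly_bits_sign _)).
Qed.

End Phases.

(** Serves real and imaginary parts, conjugation and the embedding of the reals. Additivity suffices
    because the only products in a sign polynomial are with 1 and -1. *)
Lemma poly_signs_additive {A B : comPzRingType} (phi : A -> B) n d (f : seq bool -> A) :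
  {morph phi : x y / x + y} -> poly_signs n d f -> poly_signs n d (fun s => phi (f s)).
Proof.
move=> phiD; have phi0 : phi 0 = 0 by apply: (addrI (phi 0)); rewrite -phiD !addr0.
have phiN x : phi (- x) = - phi x by apply: (addrI (phi x)); rewrite -phiD !subrr.
elim: n d f => [|n IH] d f //= [g [h [pg ph h0 E]]].
exists (fun s => phi (g s)), (fun s => phi (h s)); split; try exact: IH.
  by move=> /h0 ->; rewrite phi0.
by move=> b s; rewrite E; case: b; rewrite ?expr0 ?expr1 ?mul1r ?mulN1r phiD ?phiN.
Qed.

(** * States, channels and roots of unity *)

Local Open Scope sesquilinear_scope.

Section QuantumBasics.
Context {R : realType}.
Local Notation C := R[i].
Local Notation Re := (@complex.Re R).

Lemma conjc_realE (r : R) : (r%:C%C)^* = r%:C%C.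
Proof. by rewrite conj_Creal // complex_real. Qed.

Lemma adjointE m n (A : 'M[C]_(m, n)) i j : A^t* i j = (A j i)^*.
Proof. by rewrite !mxE. Qed.

Lemma adjointM m n p (A : 'M[C]_(m, n)) (B : 'M[C]_(n, p)) :
  (A *m B)^t* = B^t* *m A^t*.
Proof. by rewrite trmx_mul map_mxM. Qed.

Lemma adjointZ m n (a : C) (A : 'M[C]_(m, n)) : (a *: A)^t* = a^* *: A^t*.
Proof. by apply/matrixP => i j; rewrite !mxE rmorphM. Qed.

Lemma gram_ge0 n (v : 'cV[C]_n) : 0 <= (v^t* *m v) 0 0.
Proof. by rewrite mxE; apply: sumr_ge0 => k _; rewrite adjointE mulrC mul_conjC_ge0. Qed.

Lemma psd_gram m n (B : 'M[C]_(n, m)) : is_psd (B *m B^t*).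
Proof.
split=> [|v]; first by rewrite adjointM trmxCK.
rewrite (_ : _ *m v = (B^t* *m v)^t* *m (B^t* *m v)) ?gram_ge0 //.
by rewrite adjointM trmxCK !mulmxA.
Qed.

Lemma psd_scale n (r : R) (A : 'M[C]_n) : 0 <= r -> is_psd A -> is_psd (r%:C%C *: A).
Proof.
move=> r0 [hA pA]; split=> [|v]; first by rewrite adjointZ hA conjc_realE.
by rewrite -scalemxAr -scalemxAl mxE mulr_ge0 ?ler0c.
Qed.

Lemma psd_diag n (d : 'rV[C]_n) : (forall i, 0 <= d 0 i) -> is_psd (diag_mx d).
Proof.
move=> d0; split=> [|v].
  apply/matrixP => i j; rewrite adjointE !mxE eq_sym; case: eqVneq => [->|_].
    by rewrite !mulr1n conj_Creal // ger0_real.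
  by rewrite !mulr0n rmorph0.
rewrite mxE; apply: sumr_ge0 => k _; rewrite mul_mx_diag mxE adjointE.
by rewrite mulrAC mulr_ge0 // mulrC mul_conjC_ge0.
Qed.

Lemma trace_gram_mul n (X : 'M[C]_n) (v : 'cV[C]_n) :
  \tr (X *m (v *m v^t*)) = (v^t* *m X *m v) 0 0.
Proof. by rewrite mulmxA mxtrace_mulC mulmxA trace_mx11. Qed.

Section Channel.
Context {din dout : nat} (Phi : 'M[C]_din -> 'M[C]_dout).
Hypothesis chPhi : is_channel Phi.

Lemma channel_sum_delta X : Phi X = \sum_i \sum_j X i j *: Phi (delta_mx i j).
Proof.
have [K [A [PhiE _]]] := chPhi; rewrite PhiE [in LHS](matrix_sum_delta X).
under eq_bigr => k _.
  rewrite mulmx_sumr mulmx_suml; under eq_bigr => i _.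
    rewrite mulmx_sumr mulmx_suml.
    under eq_bigr => j _ do rewrite -scalemxAr -scalemxAl.
    over.
  over.
rewrite exchange_big; apply: eq_bigr => i _ /=.
rewrite exchange_big; apply: eq_bigr => j _ /=.
by rewrite PhiE scaler_sumr.
Qed.

Lemma channel_psd X : is_psd X -> is_psd (Phi X).
Proof.
have [K [A [PhiE _]]] := chPhi => -[hX pX]; rewrite PhiE; split=> [|v].
  apply/matrixP => i j; rewrite adjointE !summxE rmorph_sum; apply: eq_bigr => k _.
  by rewrite /= -[LHS]adjointE !adjointM trmxCK hX mulmxA.
rewrite mulmx_sumr mulmx_suml summxE; apply: sumr_ge0 => k _.
have := pX ((A k)^t* *m v); rewrite adjointM trmxCK.
by rewrite !mulmxA.
Qed.

Lemma channel_trace X : \tr (Phi X) = \tr X.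
Proof.
have [K [A [PhiE A1]]] := chPhi; rewrite PhiE raddf_sum /=.
under eq_bigr => k _ do rewrite -mulmxA mxtrace_mulC -mulmxA mulmxA.
rewrite -[in RHS](mul1mx X) -A1 mulmx_suml raddf_sum /=; apply: eq_bigr => k _.
by rewrite [RHS]mxtrace_mulC mulmxA.
Qed.

End Channel.

(** X^n - 1 splits and is separable in characteristic 0, so there are enough distinct n-th roots of
    unity to contain a primitive one. *)
Lemma primitive_root_exists n : (0 < n)%N -> exists z : C, n.-primitive_root z.
Proof.
pose p : {poly C} := 'X^n - 1; have [r Dp] := closed_field_poly_normal p.
move=> n_gt0; rewrite (monicP _) ?monicXnsubC // scale1r in Dp.
have rn1 : all n.-unity_root r by apply/allP => z; rewrite -root_prod_XsubC -Dp.
have sz_r : (n < (size r).+1)%N.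
  by rewrite -(size_prod_XsubC r id) -Dp size_XnsubC.
have [|z _ zP] := hasP (has_prim_root n_gt0 rn1 _ sz_r); last by exists z.
by rewrite -separable_prod_XsubC -Dp separable_Xn_sub_1 // pnatr_eq0 -lt0n.
Qed.

Lemma primitive_root_norm n (z : C) : n.-primitive_root z -> z * z^* = 1.
Proof.
move=> zP; have n0 := prim_order_gt0 zP.
have /eqP : `|z| ^+ n = 1 by rewrite -normrX prim_expr_order // normr1.
by rewrite pexprn_eq1 // gtn_eqF // => /eqP z1; rewrite -normCK z1 expr1n.
Qed.

Lemma primitive_root_orthogonal n (z : C) (a b : 'I_n) : n.-primitive_root z ->
  \sum_(x < n) z ^+ (x * a) * (z ^+ (x * b))^* = n%:R * (a == b)%:R.
Proof.
move=> zP; have z1 := primitive_root_norm _ _ zP.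
pose y := z ^+ a * (z ^+ b)^*.
rewrite (eq_bigr (fun x : 'I_n => y ^+ x)) => [|x _]; last first.
  by rewrite /y exprMn -!rmorphXn /= -!exprM ![(_ * x)%N]mulnC.
have zb : z ^+ b * (z ^+ b)^* = 1 by rewrite rmorphXn -exprMn z1 expr1n.
have [ab|ab] := eqVneq a b.
  rewrite (eq_bigr (fun=> 1)) ?sumr_const ?card_ord ?mulr1 // => x _.
  by rewrite /y ab zb expr1n.
rewrite mulr0; have : (y - 1) * (\sum_(x < n) y ^+ x) = 0.
  rewrite -subrX1 /y exprMn -rmorphXn /= -!exprM ![(_ * n)%N]mulnC !exprM.
  by rewrite (prim_expr_order zP) !expr1n rmorph1 mulr1 subrr.
move/eqP; rewrite mulf_eq0 subr_eq0 => /orP[/eqP y1|/eqP //].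
have : z ^+ a = z ^+ b.
  by rewrite -[LHS]mulr1 -zb mulrCA -/y y1 mulr1.
move/eqP; rewrite (eq_prim_root_expr zP) !modn_small // => /eqP/val_inj.
by move/eqP: ab.
Qed.

End QuantumBasics.

(** * Random input states and random bases *)

Section Ensembles.
Context {R : realType}.
Local Notation C := R[i].
Local Notation Re := (@complex.Re R).
Local Notation toC := (real_complex R).
Local Notation bits n := {ffun 'I_n * bool -> bool}.

Lemma gramE n (v : 'cV[C]_n) i j : (v *m v^t*) i j = v i 0 * (v j 0)^*.
Proof. by rewrite mxE big_ord1 adjointE. Qed.

Definition phase_col {n} (w : bits n) : 'cV[C]_n := \col_i phase w i.

(** Subtracting the average sign gives the diagonal state trace 1; halving keeps its entries
    nonnegative, as a sign differs from the average by at most 2. *)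
Definition tilt {n} (w : bits n) (i : 'I_n) : R :=
  ((-1) ^+ w (i, false) - (\sum_j (-1) ^+ w (j, false)) / n%:R) / 2.

Definition probe {n} (r : bool) (w : bits n) : 'M[C]_n :=
  if r then ((2 * n%:R)^-1)%:C%C *: (phase_col w *m (phase_col w)^t*)
  else diag_mx (\row_i ((1 + tilt w i) / n%:R)%:C%C).

Lemma probe_state n r (w : bits n) : (0 < n)%N -> is_state (probe r w).
Proof.
move=> n0; have nR : 0 < n%:R :> R by rewrite ltr0n.
case: r; split.
- by apply: psd_scale (psd_gram _ _ _); rewrite invr_ge0 mulr_ge0 ?ler0n.
- rewrite /= mxtraceZ /mxtrace (eq_bigr (fun=> 2)) => [|i _]; last first.
    by rewrite gramE mxE phase_norm.
  rewrite sumr_const card_ord -(rmorph_nat toC) -rmorphMn -rmorphM.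
  by rewrite -[2 *+ n]mulr_natr mulVf ?rmorph1 // mulf_neq0 ?pnatr_eq0 // -lt0n.
- apply: psd_diag => i; rewrite mxE ler0c divr_ge0 ?ler0n // /tilt.
  have s1 (b : bool) : (-1 : R) <= ((-1) ^+ b : R) <= (1 : R).
    by rewrite -ler_norml normr_sign.
  have /andP[s2 _] := s1 (w (i, false)).
  have : (\sum_j (-1) ^+ w (j, false)) / n%:R <= 1 :> R.
    rewrite ler_pdivrMr // mul1r -[leRHS]mulr1 mulr_natl -[n in leRHS]card_ord -sumr_const.
    by apply: ler_sum => j _; have /andP[] := s1 (w (j, false)).
  lra.
- rewrite /= mxtrace_diag (eq_bigr (fun i => toC ((1 + tilt w i) / n%:R))) => [|i _]; last first.
    by rewrite mxE.
  rewrite -rmorph_sum -mulr_suml big_split /= sumr_const card_ord.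
  rewrite /tilt -mulr_suml sumrB sumr_const card_ord.
  rewrite (_ : _ / n%:R *+ n = \sum_j (-1) ^+ w (j, false)) ?subrr ?mul0r ?addr0.
    by rewrite divff ?gt_eqF // rmorph1.
  by rewrite -mulr_natr mulfVK // gt_eqF.
Qed.

Section Measurement.
Context {dout : nat} (z : C).
Hypothesis zP : dout.-primitive_root z.

Definition basis_vec (q : bool) (u : bits dout) (x : 'I_dout) : 'cV[C]_dout :=
  if q then \col_a (z ^+ (x * a) * phase u a) else delta_mx x 0.

Definition basis_weight (q : bool) : R := if q then (2 * dout%:R)^-1 else 1.

Definition basis_meas (q : bool) (u : bits dout) (x : 'I_dout) : 'M[C]_dout :=
  toC (basis_weight q) *: (basis_vec q u x *m (basis_vec q u x)^t*).

Lemma basis_weight_ge0 q : 0 <= basis_weight q.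
Proof. by case: q; rewrite /= ?ler01 // invr_ge0 mulr_ge0 ?ler0n. Qed.

Let d0 : dout%:R != 0 :> R.
Proof. by rewrite pnatr_eq0 -lt0n (prim_order_gt0 zP). Qed.

Let d2 : 2 * dout%:R != 0 :> R.
Proof. by rewrite mulf_neq0 // pnatr_eq0. Qed.

Let zX k : z ^+ k * (z ^+ k)^* = 1.
Proof. by rewrite rmorphXn -exprMn (primitive_root_norm _ _ zP) expr1n. Qed.

Lemma basis_meas_povm q u : is_povm (basis_meas q u).
Proof.
split=> [x|].
  exact: psd_scale (basis_weight_ge0 q) (psd_gram _ _ _).
apply/matrixP => a b; rewrite summxE !mxE.
case: q; rewrite /basis_meas /=; last first.
  under eq_bigr => x _ do rewrite rmorph1 scale1r gramE !mxE !andbT.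
  rewrite (bigD1 a) //= eqxx mul1r big1 => [|x xa]; last first.
    by rewrite eq_sym (negPf xa) mul0r.
  by rewrite addr0 rmorph_nat eq_sym.
rewrite (eq_bigr (fun x : 'I_dout => z ^+ (x * a) * (z ^+ (x * b))^* *
  (toC (2 * dout%:R)^-1 * (phase u a * (phase u b)^*)))) => [|x _]; last first.
  by rewrite mxE gramE !mxE rmorphM /=; ring.
rewrite -mulr_suml (primitive_root_orthogonal _ _ _ _ zP) eq_sym.
have [->|_] := eqVneq b a; last by rewrite mulr0 mul0r.
rewrite mulr1 mulrCA phase_norm -(rmorph_nat toC dout) -(rmorph_nat toC 2) -!(rmorphM toC).
by rewrite [_ * 2]mulrC mulVf.
Qed.

Lemma basis_meas_trace q u x : \tr (basis_meas q u x) = 1.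
Proof.
rewrite mxtraceZ /mxtrace; case: q => /=; last first.
  rewrite rmorph1 mul1r (bigD1 x) //= gramE mxE !eqxx mul1r rmorph1 big1 ?addr0 //.
  by move=> i ix; rewrite gramE mxE (negPf ix) mul0r.
rewrite (eq_bigr (fun=> 2)) => [|a _]; last first.
  by rewrite gramE mxE rmorphM mulrACA zX mul1r phase_norm.
rewrite sumr_const card_ord -(rmorph_nat toC) -rmorphMn -rmorphM.
by rewrite -[2 *+ dout]mulr_natr mulVf ?rmorph1.
Qed.

Lemma trace_basis_meas X q u x : \tr (X *m basis_meas q u x) =
  toC (basis_weight q) *
  \sum_b \sum_a X a b * (basis_vec q u x b 0 * (basis_vec q u x a 0)^*).
Proof.
rewrite -scalemxAr mxtraceZ trace_gram_mul mxE; congr (_ * _).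
apply: eq_bigr => b _; rewrite mxE mulr_suml; apply: eq_bigr => a _.
by rewrite adjointE; ring.
Qed.

(** The visibility of an output entry: diagonal entries are read off directly in the computational
    basis, off-diagonal ones enter each of the d_out Fourier outcomes with squared weight 1 /
    d_out^2. *)
Definition entry_weight (a b : 'I_dout) : R := if a == b then 1 else dout%:R^-1.

(** In the twisted Fourier basis the diagonal of [X] enters only through its trace, which vanishes,
    so the phases isolate the off-diagonal entries. *)
Lemma mean_trace_basis (X : 'M[C]_dout) : \tr X = 0 ->
  \sum_q \sum_x expect unif (fun u => normc2 (\tr (X *m basis_meas q u x))) =
  \sum_a \sum_b entry_weight a b * normc2 (X a b).
Proof.
move=> X0; rewrite big_bool /=.
have E1 x : expect unif (fun u => normc2 (\tr (X *m basis_meas true u x))) =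
    (dout%:R ^- 2) * \sum_b \sum_(a | a != b) normc2 (X a b).
  pose c b a : C := toC (basis_weight true) * (X a b * (z ^+ (x * b) * (z ^+ (x * a))^*)).
  rewrite (eq_expect _ _ (fun u => normc2 (\sum_b \sum_a c b a * (phase u b * (phase u a)^*)))).
    rewrite mean_phases_sqr (_ : \sum_i c i i = 0) ?/normc2 ?expr0n ?addr0 ?mulr0 ?add0r.
      rewrite !mulr_sumr; apply: eq_bigr => b _.
      rewrite !mulr_sumr; apply: eq_bigr => a _.
      rewrite -[LHS]/(4 * normc2 (c b a)) !normc2M normc2_conj normc2_real.
      have zn k : normc2 (z ^+ k) = 1 by apply: complexI; rewrite normc2E zX.
      by rewrite !zn !mulr1 -/(normc2 _) /=; field.
    rewrite /c -mulr_sumr (eq_bigr (fun i => X i i)) => [|i _]; last by rewrite zX mulr1.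
    by rewrite -/(\tr X) X0 mulr0.
  move=> u; congr normc2; rewrite trace_basis_meas mulr_sumr; apply: eq_bigr => b _.
  rewrite mulr_sumr; apply: eq_bigr => a _.
  by rewrite /c /= !mxE rmorphM /=; ring.
have E2 x : expect unif (fun u => normc2 (\tr (X *m basis_meas false u x))) =
    normc2 (X x x).
  rewrite (eq_expect _ _ (fun=> normc2 (X x x))) ?expect_cst //.
    by apply: unif1; exact: [ffun=> true].
  move=> u; rewrite -scalemxAr mxtraceZ trace_gram_mul /= rmorph1 mul1r.
  congr normc2; rewrite (_ : (delta_mx x 0)^t* = delta_mx 0 x :> 'M[C]__).
    by rewrite -rowE -colE !mxE.
  by apply/matrixP => i j; rewrite adjointE !mxE andbC rmorph_nat.
transitivity (\sum_(x < dout) dout%:R ^- 2 * (\sum_b \sum_(a | a != b) normc2 (X a b)) +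
    \sum_x normc2 (X x x)).
  by congr (_ + _); apply: eq_bigr => x _; [exact: E1 | exact: E2].
rewrite [RHS]exchange_big sumr_const card_ord addrC -(mulr_natl (_ * _)) mulrA /=.
rewrite (_ : dout%:R * dout%:R ^- 2 = dout%:R^-1); last by field.
rewrite mulr_sumr -big_split; apply: eq_bigr => b _ /=.
rewrite [RHS](bigD1 b) //= /entry_weight eqxx mul1r; congr (_ + _).
by rewrite mulr_sumr; apply: eq_bigr => a ab; rewrite (negPf ab).
Qed.

End Measurement.

End Ensembles.

(** * The expected signal *)

Lemma expect_unif_pair {R : realFieldType} {S T : finType} (F : S * T -> R) :
  expect unif F = expect unif (fun s => expect unif (fun t => F (s, t))).
Proof.
rewrite /expect /unif sum_pairE card_prod natrM invfM.
by apply: eq_bigr => s _; rewrite mulr_sumr; apply: eq_bigr => t _; rewrite mulrA.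
Qed.

Section Signal.
Context {R : realType} {din dout : nat}.
Local Notation C := R[i].
Local Notation Re := (@complex.Re R).
Local Notation Im := (@complex.Im R).
Local Notation toC := (real_complex R).
Local Notation bits n := {ffun 'I_n * bool -> bool}.
Context (Phi : 'M[C]_din -> 'M[C]_dout) (z : C).
Hypothesis chPhi : is_channel Phi.
Hypothesis din0 : (0 < din)%N.
Hypothesis zP : dout.-primitive_root z.

Let dout0 : (0 < dout)%N.
Proof. exact: prim_order_gt0 zP. Qed.
Let n : R := din%:R.
Let d : R := dout%:R.
Let n0 : 0 < n. Proof. by rewrite ltr0n. Qed.
Let d0 : 0 < d. Proof. by rewrite ltr0n. Qed.

Definition disc X : 'M[C]_dout := Phi X - @depolarizing R din dout X.

(** The squared Hilbert-Schmidt norm of the Choi matrix of the difference between the channel and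
    the depolarizing one. *)
Definition choi2 : R :=
  \sum_i \sum_j \sum_a \sum_b normc2 (disc (delta_mx i j) a b).

Lemma disc_sum_delta X : disc X = \sum_i \sum_j X i j *: disc (delta_mx i j).
Proof.
rewrite /disc (channel_sum_delta _ chPhi) /depolarizing.
under [RHS]eq_bigr => i _.
  under eq_bigr => j _ do rewrite scalerBr scale_scalar_mx mulrA.
  rewrite sumrB; over.
rewrite sumrB; congr (_ - _).
rewrite [in LHS](matrix_sum_delta X) !raddf_sum /= mulr_suml raddf_sum /=.
apply: eq_bigr => i _; rewrite raddf_sum /= mulr_suml raddf_sum /=.
by apply: eq_bigr => j _; rewrite mxtraceZ.
Qed.

Lemma disc_entry X a b : disc X a b = \sum_i \sum_j disc (delta_mx i j) a b * X i j.
Proof.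
rewrite disc_sum_delta summxE; apply: eq_bigr => i _.
by rewrite summxE; apply: eq_bigr => j _; rewrite mxE mulrC.
Qed.

Lemma disc_trace X : \tr (disc X) = 0.
Proof.
rewrite /disc raddfB /= (channel_trace _ chPhi) /depolarizing mxtrace_scalar.
by rewrite -(mulr_natr (_ / _)) mulfVK ?subrr // pnatr_eq0 -lt0n.
Qed.

Lemma disc_adjoint X : is_state X -> (disc X)^t* = disc X.
Proof.
case=> [/(channel_psd _ chPhi)[hX _] trX]; apply/matrixP => a b.
rewrite adjointE /disc /depolarizing trX !mxE rmorphB /= -adjointE hX; congr (_ - _).
rewrite eq_sym div1r; case: eqP => _; last by rewrite !mulr0n rmorph0.
by rewrite !mulr1n -(rmorph_nat toC) -fmorphV /= conjc_realE.
Qed.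

Definition outcome_prob (rho : 'M[C]_din) q u x : R :=
  Re (\tr (Phi rho *m basis_meas z q u x)).

Lemma outcome_prob_ge0 rho q u x : is_state rho -> 0 <= outcome_prob rho q u x.
Proof.
case=> /(channel_psd _ chPhi)[_ pX] _.
rewrite /outcome_prob -scalemxAr mxtraceZ trace_gram_mul Re_realM.
by rewrite mulr_ge0 ?basis_weight_ge0 // Re_ge0.
Qed.

Lemma sum_outcome_prob rho q u : is_state rho -> \sum_x outcome_prob rho q u x = 1.
Proof.
case=> _ tr1; transitivity (Re (\tr (Phi rho *m \sum_x basis_meas z q u x))).
  have -> : \tr (Phi rho *m \sum_x basis_meas z q u x) =
      \sum_x \tr (Phi rho *m basis_meas z q u x) by rewrite mulmx_sumr raddf_sum.
  by rewrite Re_sum.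
by rewrite (basis_meas_povm _ zP q u).2 mulmx1 (channel_trace _ chPhi) tr1.
Qed.

Lemma outcome_probB rho q u x : is_state rho ->
  outcome_prob rho q u x - d^-1 = Re (\tr (disc rho *m basis_meas z q u x)).
Proof.
case=> _ tr1; rewrite mulmxBl raddfB /= ReD ReN; congr (_ - _).
rewrite /depolarizing tr1 mul_scalar_mx mxtraceZ (basis_meas_trace _ zP) mulr1 div1r.
by rewrite -(rmorph_nat toC) -fmorphV.
Qed.

(** The difference is Hermitian on states, so its trace against a measurement operator is real. The
    squared deviation is thus a squared modulus, to which the complex Parseval identities apply. *)
Lemma outcome_probB_sqr rho q u x : is_state rho ->
  (outcome_prob rho q u x - d^-1) ^+ 2 = normc2 (\tr (disc rho *m basis_meas z q u x)).
Proof.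
move=> st; rewrite outcome_probB // Re_sqr_normc2 //.
rewrite -scalemxAr mxtraceZ trace_gram_mul rmorphM /= conjc_realE; congr (_ * _).
by rewrite -adjointE !adjointM trmxCK disc_adjoint // mulmxA.
Qed.

Definition signal (s : bits din) (u : bits dout) : R :=
  \sum_r \sum_q \sum_x (outcome_prob (probe r s) q u x - d^-1) ^+ 2.

Let wnorm (X : 'M[C]_dout) : R := \sum_a \sum_b entry_weight a b * normc2 (X a b).

Let mean_signal_u s : expect unif (signal s) = \sum_r wnorm (disc (probe r s)).
Proof.
rewrite expect_sum; apply: eq_bigr => r _.
rewrite /wnorm -(mean_trace_basis _ zP) ?disc_trace // expect_sum.
apply: eq_bigr => q _; rewrite expect_sum; apply: eq_bigr => x _.
by apply: eq_expect => u; rewrite outcome_probB_sqr //; exact: probe_state.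
Qed.

Let poly_cst {I : finType} (A : comPzRingType) e (a : A) :
  poly_bits e (fun _ : {ffun I -> bool} => a).
Proof. exact: poly_signs_cst. Qed.

Let poly_basis_vec q (x a : 'I_dout) : poly_bits 1 (fun u => basis_vec z q u x a 0).
Proof.
apply: (@poly_signs_ext _ _ _ (fun s => if q then z ^+ (x * a) * phase (bits_of_seq s) a
    else (delta_mx x 0 : 'cV[C]_dout) a 0)).
  by move=> s; case: q => //=; rewrite mxE.
by case: q; [apply: poly_signsZ; exact: poly_bits_phase | exact: poly_cst].
Qed.

Let poly_basis_vec_conj q (x a : 'I_dout) : poly_bits 1 (fun u => (basis_vec z q u x a 0)^*).
Proof.
apply: (poly_signs_additive (fun y : C => y^* ) _ _ _ _ (poly_basis_vec q x a)) => y y'.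
exact: rmorphD.
Qed.

Let poly_trace_basis (X : 'M[C]_dout) q (x : 'I_dout) : poly_bits 2 (fun u => \tr (X *m basis_meas z q u x)).
Proof.
apply: poly_signs_ext => [s|]; first by rewrite trace_basis_meas; reflexivity.
apply: poly_signsZ; apply: poly_signs_sum => b; apply: poly_signs_sum => a.
by apply: poly_signsZ; exact: (poly_signsM _ 1 1 _ _ (poly_basis_vec _ _ _) (poly_basis_vec_conj _ _ _)).
Qed.

(** For a fixed input seed every deviation has degree 2 in the basis bits, one polynomial for each
    test and outcome. *)
Let second_signal_u s :
  expect unif (fun u => signal s u ^+ 2) <= 81 * expect unif (signal s) ^+ 2.
Proof.
pose F (j : bool * (bool * 'I_dout)) u : R :=
  Re (\tr (disc (probe j.1 s) *m basis_meas z j.2.1 u j.2.2)).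
have FE u : signal s u = \sum_j F j u ^+ 2.
  rewrite sum_pairE; apply: eq_bigr => r _; rewrite sum_pairE.
  apply: eq_bigr => q _; apply: eq_bigr => x _.
  by rewrite outcome_probB //; exact: probe_state.
rewrite (eq_expect _ _ _ FE) (eq_expect _ _ (fun u => (\sum_j F j u ^+ 2) ^+ 2)).
  rewrite (_ : 81 = 9 ^+ 2 :> R); last by ring.
  apply: hypercontractivity => -[r [q x]].
  apply: (poly_signs_additive Re _ 2 _ ReD).
  exact: poly_trace_basis.
by move=> u; rewrite FE.
Qed.

Let poly_probe r i j : poly_bits 2 (fun s : bits din => (probe r s : 'M[C]_din) i j).
Proof.
case: r => /=.
  apply: poly_signs_ext => [s|]; first by rewrite mxE gramE !mxE; reflexivity.
  by apply: poly_signsZ; exact: (poly_signsM _ 1 1 _ _ (poly_bits_phase _) (poly_bits_phase_conj _)).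
have [<-|ij] := eqVneq i j; last first.
  apply: poly_signs_ext => [s|]; last exact: (poly_cst _ _ 0).
  by rewrite !mxE (negPf ij).
apply: (@poly_signs_ext _ _ _ (fun s => toC (n^-1 * (1 + 2^-1 * ((-1) ^+ bits_of_seq s (i, false)
   + - n^-1 * \sum_j (-1) ^+ bits_of_seq s (j, false)))))) => [s|].
  rewrite !mxE eqxx /= mulr1n; congr toC; rewrite /tilt -/n.
  by rewrite [RHS]mulrC; congr (_ * (_ + _)); rewrite [RHS]mulrC mulNr; congr (_ * (_ - _)); rewrite mulrC.
apply: (poly_signs_additive toC _ 2 _ (rmorphD toC)).
have P1 k : poly_bits 2 (fun s : bits din => (-1) ^+ s (k, false) : R).
  by apply: (poly_signs_le _ 1) => //; exact: poly_bits_sign.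
apply: poly_signsZ; apply: poly_signsD; first exact: poly_cst.
apply: poly_signsZ; apply: poly_signsD; first exact: P1.
by apply: poly_signsZ; apply: poly_signs_sum => k; exact: P1.
Qed.

Let poly_disc_probe r a b : poly_bits 2 (fun s => disc (probe r s) a b).
Proof.
apply: poly_signs_ext => [s|]; first by rewrite disc_entry; reflexivity.
apply: poly_signs_sum => i; apply: poly_signs_sum => j.
by apply: poly_signsZ; exact: poly_probe.
Qed.

Let second_signal_s :
  expect unif (fun s => (\sum_r wnorm (disc (probe r s))) ^+ 2) <=
  81 * expect unif (fun s => \sum_r wnorm (disc (probe r s))) ^+ 2.
Proof.
(* Real polynomials are required, so each complex entry is split into real and imaginary parts and
   its weight is absorbed as a square root. *)
pose F (j : bool * (('I_dout * 'I_dout) * bool)) s : R :=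
  Num.sqrt (entry_weight j.2.1.1 j.2.1.2) *
  (let y := disc (probe j.1 s) j.2.1.1 j.2.1.2 in if j.2.2 then Re y else Im y).
have FE s : \sum_r wnorm (disc (probe r s)) = \sum_j F j s ^+ 2.
  rewrite sum_pairE; apply: eq_bigr => r _; rewrite sum_pairE sum_pairE.
  apply: eq_bigr => a _; apply: eq_bigr => b _; rewrite big_bool /F /= !exprMn.
  rewrite sqr_sqrtr /normc2 ?mulrDr // /entry_weight.
  by case: ifP; rewrite ?ler01 // invr_ge0 ler0n.
rewrite (eq_expect _ _ _ FE) (eq_expect _ _ (fun u => (\sum_j F j u ^+ 2) ^+ 2)).
  rewrite (_ : 81 = 9 ^+ 2 :> R); last by ring.
  apply: hypercontractivity => -[r [[a b] q]]; apply: poly_signsZ.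
  case: q.
    by apply: (poly_signs_additive Re _ 2 _ ReD); exact: poly_disc_probe.
  by apply: (poly_signs_additive Im _ 2 _ ImD); exact: poly_disc_probe.
by move=> u; rewrite FE.
Qed.

Definition mean_signal : R := expect unif (fun w : bits din * bits dout => signal w.1 w.2).

Let mean_signalE : mean_signal = expect unif (fun s => \sum_r wnorm (disc (probe r s))).
Proof.
rewrite /mean_signal expect_unif_pair; apply: eq_expect => s.
by rewrite -mean_signal_u.
Qed.

(** Hypercontractivity is used twice: in the basis bits with the input seed fixed, then in the input
    bits for the mean over bases, which is again a sum of squares. *)
Lemma second_signal :
  expect unif (fun w : bits din * bits dout => signal w.1 w.2 ^+ 2) <=
  81 ^+ 2 * mean_signal ^+ 2.
Proof.
rewrite expect_unif_pair /=.
apply: (@le_trans _ _ (expect unif (fun s => 81 * (\sum_r wnorm (disc (probe r s))) ^+ 2))).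
  apply: ler_expect => s; first exact: unif_ge0.
  by rewrite -mean_signal_u second_signal_u.
by rewrite expectZ mean_signalE [81 ^+ 2]expr2 -mulrA ler_wpM2l ?ler0n // second_signal_s.
Qed.

Let A i j a b := disc (delta_mx i j) a b.

Let probe_trueE (s : bits din) i j :
  probe true s i j = toC (2 * n)^-1 * (phase s i * (phase s j)^* ).
Proof. by rewrite /= mxE gramE !mxE. Qed.

Let probe_falseE (s : bits din) i j :
  probe false s i j = toC ((1 + tilt s i) / n) *+ (i == j).
Proof. by rewrite /= !mxE. Qed.

(** Diagonal matrix units contribute only the square of their sum, which is dropped. The constant is
    4 / (2n)^2. *)
Let mean_probe_true a b :
  expect unif (fun s => normc2 (disc (probe true s) a b)) >=
  n ^- 2 * \sum_i \sum_(j | j != i) normc2 (A i j a b).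
Proof.
rewrite (eq_expect _ _ (fun s => normc2 (\sum_i \sum_j (toC (2 * n)^-1 * A i j a b) *
    (phase s i * (phase s j)^*)))); last first.
  move=> s; congr normc2; rewrite disc_entry; apply: eq_bigr => i _.
  by apply: eq_bigr => j _; rewrite probe_trueE /A; ring.
rewrite mean_phases_sqr addrC; apply: ler_wpDr; first by rewrite mulr_ge0 ?normc2_ge0.
rewrite !mulr_sumr; apply: ler_sum => i _; rewrite !mulr_sumr; apply: ler_sum => j _.
rewrite normc2M normc2_real; have nn : n != 0 by rewrite gt_eqF.
by rewrite le_eqVlt; apply/orP; left; apply/eqP; field.
Qed.

Let sum_dev (c : 'I_din -> C) :
  \sum_i normc2 (c i - toC n^-1 * \sum_j c j) =
  \sum_i normc2 (c i) - n^-1 * normc2 (\sum_j c j).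
Proof.
have nn : n != 0 by rewrite gt_eqF.
have real (x : 'I_din -> R) : \sum_i (x i - n^-1 * \sum_j x j) ^+ 2 =
    \sum_i x i ^+ 2 - n^-1 * (\sum_j x j) ^+ 2.
  set m := \sum_j x j.
  rewrite (eq_bigr (fun i => x i ^+ 2 + ((- 2 * (n^-1 * m)) * x i + (n^-1 * m) ^+ 2))).
    rewrite !big_split /= -mulr_sumr sumr_const card_ord -/m -(mulr_natl ((_ * _) ^+ 2)) -/n.
    by field.
  by move=> i _; ring.
have ImS (I : finType) (F : I -> C) : Im (\sum_i F i) = \sum_i Im (F i).
  exact: (big_morph Im ImD erefl).
rewrite /normc2 [in RHS]big_split /= mulrDr opprD addrACA Re_sum ImS -!real -big_split /=.
apply: eq_bigr => i _.
by rewrite ReD ImD ReN ImN Re_realM Im_realM Re_sum ImS.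
Qed.

(** Each entry is affine in the signs. The linear coefficients only see the deviations of the
    [A i i a b] from their average; the loss is a multiple of the squared sum, and the constant
    term, the response to the maximally mixed state, outweighs it since n^-1 <= 4. *)
Let mean_probe_false a b :
  expect unif (fun s => normc2 (disc (probe false s) a b)) >=
  (4 * n ^+ 2)^-1 * \sum_i normc2 (A i i a b).
Proof.
have nn : n != 0 by rewrite gt_eqF.
pose S := \sum_i A i i a b.
rewrite (eq_expect _ _ (fun s => normc2 (toC n^-1 * S + \sum_i (toC (2 * n)^-1 *
    (A i i a b - toC n^-1 * S)) * sign_bit s i))).
  rewrite mean_signs_sqr normc2M normc2_real.
  under [X in _ <= _ + X]eq_bigr => i _ do rewrite normc2M normc2_real.
  rewrite -mulr_sumr sum_dev -/S.
  set T := \sum_i _; have n1 : n^-1 <= 1 by rewrite invf_le1 // ler1n.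
  have -> : n^-1 ^+ 2 = 4 * (4 * n ^+ 2)^-1 by field.
  have -> : (2 * n)^-1 ^+ 2 = (4 * n ^+ 2)^-1 by field.
  have c0 : 0 <= (4 * n ^+ 2)^-1 by rewrite invr_ge0 mulr_ge0 ?sqr_ge0.
  rewrite -subr_ge0 (_ : _ - _ = (4 * n ^+ 2)^-1 * (normc2 S * (4 - n^-1))); last by ring.
  apply: mulr_ge0 => //; apply: mulr_ge0; first exact: normc2_ge0.
  by lra.
move=> s; congr normc2; rewrite disc_entry.
transitivity (\sum_i A i i a b * toC ((1 + tilt s i) / n)).
  apply: eq_bigr => i _; rewrite (bigD1 i) //= big1 ?addr0 => [|j ji]; last first.
    by rewrite probe_falseE eq_sym (negPf ji) mulr0n mulr0.
  by rewrite probe_falseE eqxx mulr1n.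
pose e i : C := sign_bit s i; pose E := \sum_j e j.
have tE i : toC ((1 + tilt s i) / n) = toC n^-1 + toC (2 * n)^-1 * (e i - toC n^-1 * E).
  rewrite /tilt -/n /E /e /sign_bit.
  rewrite (_ : \sum_j _ = toC (\sum_j (-1) ^+ s (j, false))); last first.
    by rewrite rmorph_sum; apply: eq_bigr => j _; rewrite rmorph_sign.
  rewrite -(rmorph_sign toC) -!rmorphM -rmorphB -!rmorphM -rmorphD; congr toC.
  by field.
under eq_bigr => i _ do rewrite tE mulrDr.
rewrite big_split /= -mulr_suml -/S [S * _]mulrC; congr (_ + _).
under eq_bigr => i _ do rewrite mulrCA mulrBr.
rewrite -mulr_sumr sumrB -mulr_suml -/S.
under [RHS]eq_bigr => i _ do rewrite -mulrA mulrBl.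
rewrite -mulr_sumr sumrB -mulr_sumr -/E; congr (_ * (_ - _)).
by ring.
Qed.

Lemma mean_signal_ge : choi2 / (4 * n ^+ 2 * d) <= mean_signal.
Proof.
rewrite mean_signalE.
rewrite (eq_expect _ _ (fun s => \sum_a \sum_b (entry_weight a b * normc2 (disc (probe true s) a b)
   + entry_weight a b * normc2 (disc (probe false s) a b)))); last first.
  by move=> s; rewrite big_bool /wnorm -big_split; apply: eq_bigr => a _; rewrite -big_split.
rewrite expect_sum /choi2.
under [X in X / _]eq_bigr => i _ do rewrite exchange_big.
rewrite exchange_big mulr_suml; apply: ler_sum => a _ /=.
under eq_bigr => i _ do rewrite exchange_big.
rewrite expect_sum exchange_big mulr_suml; apply: ler_sum => b _ /=.
rewrite expectD !expectZ -mulrDr.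
have m0 c : 0 <= expect unif (fun s => normc2 (disc (probe c s) a b)).
  by apply: sumr_ge0 => s _; apply: mulr_ge0; rewrite ?unif_ge0 ?normc2_ge0.
have w1 : d^-1 <= entry_weight a b.
  by rewrite /entry_weight -/d; case: ifP => // _; rewrite invf_le1 // ler1n.
have lb := lerD (mean_probe_true a b) (mean_probe_false a b).
have dV0 : 0 <= d^-1 by rewrite invr_ge0 ltW.
apply: (@le_trans _ _ _ _ _ _ (ler_wpM2r (addr_ge0 (m0 true) (m0 false)) w1)).
apply: (@le_trans _ _ _ _ _ _ (ler_wpM2l dV0 lb)).
rewrite invfM mulrA [X in X <= _]mulrC; apply: ler_wpM2l => //.
rewrite mulr_suml !mulr_sumr -big_split; apply: ler_sum => i _ /=.
rewrite (bigD1 i) //= mulrDl addrC [X in X + _]mulrC [X in _ + X]mulrC; apply: lerD => //.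
apply: ler_wpM2r; first by apply: sumr_ge0 => j _; exact: normc2_ge0.
rewrite lef_pV2 ?posrE ?mulr_gt0 ?exprn_gt0 //.
by rewrite ler_peMl ?sqr_ge0 // ler1n.
Qed.

End Signal.

(** * Trace norm *)

Section TraceNorm.
Context {R : realType}.
Local Notation C := R[i].
Local Notation Re := (@complex.Re R).
Local Notation toC := (real_complex R).

Lemma Re_mul_le (x y : C) : 2 * Re (x * y) <= normc2 x + normc2 y.
Proof.
case: x => a b; case: y => c d; rewrite /normc2 /=.
by have := sqr_ge0 (a - c); have := sqr_ge0 (b + d); nra.
Qed.

Lemma normc2_Re (x : C) : normc2 x = Re (x * x^*).
Proof. by rewrite -normc2E. Qed.

(** The right side is symmetrized over pairs of indices and compared with the expanded left side
    pair by pair, which avoids roots and discriminants. *)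
Lemma normc2_cauchy_schwarz {I : finType} (x y : I -> C) :
  normc2 (\sum_i x i * y i) <= (\sum_i normc2 (x i)) * (\sum_i normc2 (y i)).
Proof.
have -> : (\sum_i normc2 (x i)) * (\sum_i normc2 (y i)) =
    2^-1 * \sum_i \sum_j (normc2 (x i) * normc2 (y j) + normc2 (x j) * normc2 (y i)).
  have E : \sum_i \sum_j normc2 (x i) * normc2 (y j) =
      (\sum_i normc2 (x i)) * (\sum_i normc2 (y i)).
    by rewrite mulr_suml; apply: eq_bigr => i _; rewrite mulr_sumr.
  under [in RHS]eq_bigr => i _ do rewrite big_split /=.
  by rewrite [in RHS]big_split /= [X in _ = _ * (_ + X)]exchange_big /= E; field.
rewrite normc2_Re rmorph_sum mulr_suml Re_sum mulr_sumr; apply: ler_sum => i _.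
rewrite mulr_sumr Re_sum mulr_sumr; apply: ler_sum => j _ /=.
have := Re_mul_le (x i * (y j)^*) (y i * (x j)^*).
rewrite !normc2M !normc2_conj rmorphM /=.
rewrite (_ : x i * (y j)^* * (y i * (x j)^*) = x i * y i * ((x j)^* * (y j)^*)); last by ring.
lra.
Qed.

Lemma normc2B_le (x y : C) : normc2 (x - y) <= 2 * normc2 x + 2 * normc2 y.
Proof.
case: x => a b; case: y => c d; rewrite /normc2 /=.
by have := sqr_ge0 (a + c); have := sqr_ge0 (b + d); nra.
Qed.

Lemma gram_normc2 n (v : 'cV[C]_n) : (v^t* *m v) 0 0 = toC (\sum_i normc2 (v i 0)).
Proof.
rewrite mxE rmorph_sum; apply: eq_bigr => i _.
by rewrite adjointE mulrC /= normc2E.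
Qed.

Lemma adjoint_diag n (s : 'I_n -> R) :
  (diag_mx (\row_i toC (s i)))^t* = diag_mx (\row_i toC (s i)).
Proof.
apply/matrixP => i j; rewrite adjointE !mxE eq_sym; case: eqVneq => [->|_].
  by rewrite !mulr1n conjc_realE.
by rewrite !mulr0n rmorph0.
Qed.

Lemma spectral_gram m n (X : 'M[C]_(m, n)) : exists (P : 'M[C]_n) (D : 'I_n -> R),
  [/\ P *m P^t* = 1%:M, P^t* *m P = 1%:M, forall i, 0 <= D i,
      (forall i, spectral_diag (X^t* *m X) 0 i = toC (D i))
    & (X *m P^t*)^t* *m (X *m P^t*) = diag_mx (\row_i toC (D i))].
Proof.
set H := X^t* *m X; have hH : H^t* = H by rewrite adjointM trmxCK.
have nH : H \is normalmx by apply/normalmxP; rewrite hH.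
pose P := spectralmx H; have uP : P \is unitarymx := spectral_unitarymx H.
have PP : P *m P^t* = 1%:M by apply/unitarymxP.
have PP' : P^t* *m P = 1%:M by rewrite -(invmx_unitary uP) mulVmx // unitarymx_unit.
have /orthomx_spectralP HE := nH.
have B : (X *m P^t*)^t* *m (X *m P^t*) = diag_mx (spectral_diag H).
  rewrite adjointM trmxCK mulmxA -(mulmxA P) -/H [in LHS]HE -/P invmx_unitary //.
  by rewrite !mulmxA PP mul1mx -mulmxA PP mulmx1.
have DE i : spectral_diag H 0 i = toC (\sum_j normc2 ((X *m P^t*) j i)).
  have /matrixP/(_ i i) := B; rewrite [RHS]mxE eqxx mulr1n => <-.
  rewrite mxE rmorph_sum; apply: eq_bigr => j _.
  by rewrite adjointE mulrC /= normc2E.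
exists P, (fun i => \sum_j normc2 ((X *m P^t*) j i)); split=> //.
  by move=> i; apply: sumr_ge0 => j _; exact: normc2_ge0.
by rewrite B; congr diag_mx; apply/rowP => i; rewrite mxE DE.
Qed.

Lemma gram_projection n (Q : 'M[C]_n) (v : 'cV[C]_n) :
  Q^t* = Q -> Q *m Q = Q -> (v^t* *m Q *m v) 0 0 <= (v^t* *m v) 0 0.
Proof.
move=> hQ QQ; rewrite -subr_ge0.
have E : (v - Q *m v)^t* *m (v - Q *m v) = v^t* *m v - v^t* *m Q *m v.
  have -> : (v - Q *m v)^t* = v^t* - v^t* *m Q.
    by rewrite -[in RHS]hQ -adjointM; apply/matrixP => i j; rewrite !mxE rmorphB.
  rewrite mulmxBr !mulmxBl.
  have -> : v^t* *m Q *m (Q *m v) = v^t* *m Q *m v.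
    by rewrite mulmxA -(mulmxA (v^t*)) QQ.
  have cancel (A B : 'M[C]_1) : A - B - (B - B) = A - B by rewrite subrr subr0.
  by rewrite (mulmxA (v^t*) Q v) cancel.
have mxB (A B : 'M[C]_1) : (A - B) 0 0 = A 0 0 - B 0 0 by rewrite !mxE.
by have := gram_ge0 _ (v - Q *m v); rewrite E mxB.
Qed.

(** The relation [W *m E = W] says that [W] is a partial isometry, so [W *m W^t*] is an orthogonal
    projection; the unitary factor leaves the norm unchanged. *)
Lemma contraction_gram n (P W E : 'M[C]_n) (v : 'cV[C]_n) :
  P *m P^t* = 1%:M -> W^t* *m W = E -> W *m E = W ->
  \sum_i normc2 ((P^t* *m W^t* *m v) i 0) <= \sum_i normc2 (v i 0).
Proof.
move=> PP WW WE; rewrite -lecR -(gram_normc2 _ v) -(gram_normc2 _ (P^t* *m W^t* *m v)).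
have -> : (P^t* *m W^t* *m v)^t* *m (P^t* *m W^t* *m v) = v^t* *m (W *m W^t*) *m v.
  rewrite adjointM adjointM !trmxCK -!mulmxA; congr (_ *m (_ *m _)).
  by rewrite mulmxA PP mul1mx.
apply: gram_projection; first by rewrite adjointM trmxCK.
by rewrite mulmxA -(mulmxA W) WW WE.
Qed.

(** The adjoint of the partial isometry in the polar decomposition of [X] turns it into its absolute
    value, whose trace is the sum of the singular values. Only the existence of one such contraction
    is needed for the upper bound. *)
Lemma schatten1_dual n (X : 'M[C]_n) : exists U : 'M[C]_n,
  (forall v : 'cV[C]_n, \sum_i normc2 ((U *m v) i 0) <= \sum_i normc2 (v i 0)) /\
  schatten1 X = Re (\tr (U *m X)).
Proof.
have [P [D [PP PP' D0 DE BB]]] := spectral_gram _ _ X.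
set B := X *m P^t* in BB; pose s i := Num.sqrt (D i).
(* The inverse of 0 is 0, so [W] is zero on the directions of vanishing singular value and no rank
   hypothesis arises. *)
pose W := B *m diag_mx (\row_i toC (s i)^-1).
have s2 i : s i * s i = D i by rewrite -expr2 sqr_sqrtr.
pose e i := (s i)^-1 * D i * (s i)^-1.
have sD i : (s i)^-1 * D i = s i.
  rewrite -s2; have [->|si] := eqVneq (s i) 0; first by rewrite !mulr0.
  by rewrite mulKf.
have se i : (s i)^-1 * e i = (s i)^-1.
  rewrite /e sD; have [->|si] := eqVneq (s i) 0; first by rewrite invr0 !mul0r.
  by rewrite divff // mulr1.
have WW : W^t* *m W = diag_mx (\row_i toC (e i)).
  rewrite adjointM adjoint_diag mulmxA -(mulmxA _ (B^t*) B) BB !mulmx_diag.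
  by congr diag_mx; apply/rowP => i; rewrite !mxE -!rmorphM.
have We : W *m diag_mx (\row_i toC (e i)) = W.
  rewrite -mulmxA mulmx_diag; congr (_ *m diag_mx _).
  by apply/rowP => i; rewrite !mxE -rmorphM se.
exists (P^t* *m W^t*); split=> [v|]; last first.
  rewrite -mulmxA mxtrace_mulC -mulmxA -/B /schatten1.
  rewrite adjointM adjoint_diag -mulmxA BB mulmx_diag mxtrace_diag Re_sum.
  by apply: eq_bigr => i _; rewrite DE !mxE -rmorphM /= sD.
exact: (contraction_gram _ _ _ _ _ PP WW We).
Qed.

Lemma psd_factor n (rho : 'M[C]_n) : is_psd rho -> exists S : 'M[C]_n, rho = S *m S^t*.
Proof.
case=> hH pH.
have nH : rho \is normalmx by apply/normalmxP; rewrite hH.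
pose P := spectralmx rho; have uP : P \is unitarymx := spectral_unitarymx rho.
have PP : P *m P^t* = 1%:M by apply/unitarymxP.
have /orthomx_spectralP HE := nH.
rewrite -/P invmx_unitary // in HE.
have DD : P *m rho *m P^t* = diag_mx (spectral_diag rho).
  by rewrite [X in P *m X *m _]HE !mulmxA PP mul1mx -mulmxA PP mulmx1.
have D0 i : 0 <= spectral_diag rho 0 i.
  pose v : 'cV[C]_n := delta_mx i 0.
  have := pH (P^t* *m v).
  have -> : (P^t* *m v)^t* *m rho *m (P^t* *m v) = v^t* *m (P *m rho *m P^t*) *m v.
    by rewrite adjointM trmxCK !mulmxA.
  rewrite DD /v.
  rewrite (_ : (delta_mx i 0)^t* = delta_mx 0 i :> 'M[C]__); last first.
    by apply/matrixP => k l; rewrite adjointE !mxE andbC rmorph_nat.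
  by rewrite -rowE -colE !mxE eqxx mulr1n.
pose T : 'M[C]_n := diag_mx (\row_i sqrtC (spectral_diag rho 0 i)).
have TT : T *m T^t* = diag_mx (spectral_diag rho).
  apply/matrixP => i j; rewrite mul_diag_mx !mxE eq_sym.
  case: eqVneq => [->|_]; last by rewrite !mulr0n rmorph0 mulr0.
  by rewrite !mulr1n geC0_conj ?sqrtC_ge0 // -expr2 sqrtCK.
by exists (P^t* *m T); rewrite adjointM trmxCK !mulmxA -(mulmxA _ T) TT.
Qed.

Lemma sum_mxtens m n (V : nmodType) (F : 'I_(m * n) -> V) :
  \sum_p F p = \sum_i \sum_a F (mxtens_index (i, a)).
Proof.
rewrite pair_bigA (reindex (@mxtens_index m n)) /=.
  by apply: eq_bigr => -[].
exists (@mxtens_unindex m n) => x _; [exact: mxtens_indexK | exact: mxtens_unindexK].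
Qed.

Lemma id_tens_entry n m p (F : 'M[C]_m -> 'M[C]_p) rho (i j : 'I_n) a b :
  id_tens F rho (mxtens_index (i, a)) (mxtens_index (j, b)) =
  F (tens_block rho i j) a b.
Proof.
rewrite /id_tens summxE (bigD1 i) //= [X in _ + X]big1 ?addr0 => [|k ki]; last first.
  by rewrite summxE big1 // => l _; rewrite tensmxE mxE eq_sym (negPf ki) mul0r.
rewrite summxE (bigD1 j) //= [X in _ + X]big1 ?addr0 => [|l lj]; last first.
  by rewrite tensmxE mxE [j == l]eq_sym (negPf lj) andbF mul0r.
by rewrite tensmxE mxE !eqxx mul1r.
Qed.

End TraceNorm.

(** * The diamond distance and the Choi matrix *)

Section Choi.
Context {R : realType} {din dout : nat}.
Local Notation C := R[i].
Local Notation Re := (@complex.Re R).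
Local Notation toC := (real_complex R).
Context (Phi : 'M[C]_din -> 'M[C]_dout).
Hypothesis chPhi : is_channel Phi.
Hypothesis din0 : (0 < din)%N.
Hypothesis dout0 : (0 < dout)%N.

(** The dual form of the trace norm pairs the Choi matrix with a tensor [G] built from a contraction
    and the state. Cauchy-Schwarz splits off [choi2], and what is left is to bound the squared norm
    of [G] by d_out. *)
Lemma schatten1_id_tens (rho : 'M[C]_(din * din)) : is_state rho ->
  schatten1 (id_tens (disc Phi) rho) ^+ 2 <= dout%:R * choi2 Phi.
Proof.
case=> /psd_factor[S rhoE] tr1.
have [U [Uc ->]] := schatten1_dual _ (id_tens (disc Phi) rho).
pose ix (i : 'I_din) (a : 'I_dout) := mxtens_index (i, a).
pose iy (i : 'I_din) (k : 'I_din) := mxtens_index (i, k).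
pose A k l a b := disc Phi (delta_mx k l) a b.
pose G k l a b := \sum_i \sum_j U (ix j b) (ix i a) * rho (iy i k) (iy j l).
have trE : \tr (U *m id_tens (disc Phi) rho) =
    \sum_(t : ('I_din * 'I_din) * ('I_dout * 'I_dout))
      A t.1.1 t.1.2 t.2.1 t.2.2 * G t.1.1 t.1.2 t.2.1 t.2.2.
  transitivity (\sum_j \sum_b \sum_i \sum_a \sum_k \sum_l
     A k l a b * (U (ix j b) (ix i a) * rho (iy i k) (iy j l))).
    rewrite /mxtrace sum_mxtens; apply: eq_bigr => j _; apply: eq_bigr => b _.
    rewrite mxE sum_mxtens; apply: eq_bigr => i _; apply: eq_bigr => a _.
    rewrite id_tens_entry (disc_entry _ chPhi) mulr_sumr; apply: eq_bigr => k _.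
    by rewrite mulr_sumr; apply: eq_bigr => l _; rewrite [X in _ * (_ * X)]mxE mulrCA.
  symmetry; rewrite sum_pairE sum_pairE.
  under eq_bigr => k _ do under eq_bigr => l _ do rewrite sum_pairE.
  transitivity (\sum_k \sum_l \sum_a \sum_b \sum_i \sum_j
     A k l a b * (U (ix j b) (ix i a) * rho (iy i k) (iy j l))).
    apply: eq_bigr => k _; apply: eq_bigr => l _; apply: eq_bigr => a _.
    apply: eq_bigr => b _; rewrite mulr_sumr; apply: eq_bigr => i _.
    by rewrite mulr_sumr.
  pose F (k l i j : 'I_din) (a b : 'I_dout) :=
    A k l a b * (U (ix j b) (ix i a) * rho (iy i k) (iy j l)).
  transitivity (\sum_k \sum_l \sum_i \sum_j \sum_a \sum_b F k l i j a b).
    apply: eq_bigr => k _; apply: eq_bigr => l _.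
    under eq_bigr => a _ do rewrite exchange_big.
    rewrite exchange_big; apply: eq_bigr => i _ /=.
    under eq_bigr => a _ do rewrite exchange_big.
    by rewrite exchange_big.
  transitivity (\sum_i \sum_j \sum_a \sum_b \sum_k \sum_l F k l i j a b); last first.
    rewrite exchange_big; apply: eq_bigr => j _ /=.
    rewrite [RHS]exchange_big; apply: eq_bigr => i _ /=.
    by rewrite exchange_big.
  have comm (I : finType) (H : 'I_din -> 'I_din -> I -> C) :
      \sum_k \sum_l \sum_i H k l i = \sum_i \sum_k \sum_l H k l i.
    under eq_bigr => k _ do rewrite exchange_big.
    by rewrite exchange_big.
  rewrite comm; apply: eq_bigr => i _; rewrite comm; apply: eq_bigr => j _.
  by rewrite comm; apply: eq_bigr => a _; rewrite comm.
rewrite trE.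
set t := \sum_t _; apply: (@le_trans _ _ (normc2 t)).
  by rewrite /normc2 lerDl sqr_ge0.
apply: le_trans (normc2_cauchy_schwarz _ _) _; rewrite mulrC.
have -> : \sum_(t : ('I_din * 'I_din) * ('I_dout * 'I_dout))
    normc2 (A t.1.1 t.1.2 t.2.1 t.2.2) = choi2 Phi.
  rewrite sum_pairE sum_pairE; apply: eq_bigr => k _; apply: eq_bigr => l _.
  by rewrite sum_pairE.
apply: ler_wpM2r.
  by do 4 (apply: sumr_ge0 => ? _); exact: normc2_ge0.
(* Writing the state as [S *m S^t*] lets a second Cauchy-Schwarz separate the index l from (k, a,
   b). The factor in l sums to the trace of the state, which is 1. *)
pose V j b k m a := \sum_i U (ix j b) (ix i a) * S (iy i k) m.
pose L l := \sum_j \sum_m normc2 (S (iy j l) m).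
pose M k a b := \sum_j \sum_m normc2 (V j b k m a).
have Gle k l a b : normc2 (G k l a b) <= L l * M k a b.
  have -> : G k l a b =
      \sum_(jm : 'I_din * 'I_(din * din)) (S (iy jm.1 l) jm.2)^* * V jm.1 b k jm.2 a.
    rewrite sum_pairE /G exchange_big; apply: eq_bigr => j _.
    under [RHS]eq_bigr => m _ do rewrite mulr_sumr.
    rewrite [RHS]exchange_big; apply: eq_bigr => i _ /=.
    rewrite rhoE mxE mulr_sumr; apply: eq_bigr => m _.
    by rewrite adjointE; ring.
  apply: le_trans (normc2_cauchy_schwarz _ _) _; rewrite !sum_pairE /L /M.
  by under eq_bigr => j _ do under eq_bigr => m _ do rewrite normc2_conj.
have SS : \sum_i \sum_k \sum_m normc2 (S (iy i k) m) = 1.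
  apply: complexI; rewrite rmorph1 -tr1 rhoE /mxtrace sum_mxtens rmorph_sum.
  apply: eq_bigr => i _; rewrite rmorph_sum; apply: eq_bigr => k _.
  rewrite rmorph_sum mxE; apply: eq_bigr => m _.
  by rewrite adjointE /= normc2E.
rewrite sum_pairE.
apply: (@le_trans _ _ (\sum_(kl : 'I_din * 'I_din) \sum_(ab : 'I_dout * 'I_dout)
    L kl.2 * M kl.1 ab.1 ab.2)).
  by apply: ler_sum => kl _; apply: ler_sum => ab _; exact: Gle.
rewrite sum_pairE exchange_big /=.
under eq_bigr => l _ do under eq_bigr => k _ do rewrite -mulr_sumr.
under eq_bigr => l _ do rewrite -mulr_sumr.
rewrite -mulr_suml (_ : \sum_l L l = 1) ?mul1r; last first.
  by rewrite -SS exchange_big.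
apply: (@le_trans _ _ (\sum_k \sum_(a < dout) \sum_m \sum_i normc2 (S (iy i k) m))).
  apply: ler_sum => k _; rewrite sum_pairE; apply: ler_sum => a _ /=.
  rewrite /M exchange_big /=.
  under eq_bigr => j _ do rewrite exchange_big.
  rewrite exchange_big; apply: ler_sum => m _ /=.
  (* For fixed k, m and a, the sum over j and b is the squared norm of the image under [U] of a
     column of [S] placed in the a-th output slot. Contractivity bounds it, and the free index a
     accounts for the factor d_out. *)
  pose xi : 'cV[C]_(din * dout) := \col_p
    (if (mxtens_unindex p).2 == a then S (iy (mxtens_unindex p).1 k) m else 0).
  have xiE i a' : xi (ix i a') 0 = if a' == a then S (iy i k) m else 0.
    by rewrite mxE mxtens_indexK.
  have := Uc xi; rewrite !sum_mxtens.
  rewrite (_ : \sum_i \sum_a' normc2 (xi _ 0) = \sum_i normc2 (S (iy i k) m)); last first.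
    apply: eq_bigr => i _; rewrite (bigD1 a) //= -/(ix _ _) xiE eqxx big1 ?addr0 // => a' na.
    by rewrite -/(ix _ _) xiE (negPf na) /normc2 expr0n addr0.
  apply: le_trans; rewrite le_eqVlt; apply/orP; left; apply/eqP.
  apply: eq_bigr => j _; apply: eq_bigr => b _; congr normc2.
  rewrite mxE sum_mxtens; apply: eq_bigr => i _.
  rewrite (bigD1 a) //= -!/(ix _ _) xiE eqxx big1 ?addr0 // => a' na.
  by rewrite -!/(ix _ _) xiE (negPf na) mulr0.
rewrite exchange_big (eq_bigr (fun=> 1)) ?sumr_const ?card_ord //= => _ _.
rewrite -SS [RHS]exchange_big; apply: eq_bigr => k _ /=.
by rewrite exchange_big.
Qed.

Lemma choi2_ge0 : 0 <= choi2 Phi.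
Proof. by do 4 (apply: sumr_ge0 => ? _); exact: normc2_ge0. Qed.

Lemma diamond_dist_le (eps : R) : 0 < eps ->
  eps <= diamond_dist Phi (@depolarizing R din dout) ->
  eps ^+ 2 <= dout%:R * choi2 Phi.
Proof.
move=> eps0; rewrite /diamond_dist; set E := [set _ | _ in _]%classic => le_sup.
have B0 : 0 <= dout%:R * choi2 Phi by rewrite mulr_ge0 ?ler0n ?choi2_ge0.
(* If there were no states the supremum would be 0 by convention, against [0 < eps]. *)
have [[x0 Ex0]|E0] := pselect (E !=set0)%classic; last first.
  have E0' : E = classical_sets.set0 by apply/eqP; apply: contrapT => /negP/classical_sets.set0P.
  by move: le_sup; rewrite E0' sup0 leNgt eps0.
have : eps <= Num.sqrt (dout%:R * choi2 Phi).
  apply: le_trans le_sup _; apply: ge_sup; first by exists x0.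
  move=> _ [rho /= st <-]; rewrite -ler_sqr ?nnegrE ?sqrtr_ge0 //; last first.
    by apply: sumr_ge0 => i _; exact: sqrtr_ge0.
  by rewrite sqr_sqrtr //; exact: schatten1_id_tens.
by rewrite -ler_sqr ?nnegrE ?sqrtr_ge0 ?sqr_sqrtr // ltW.
Qed.

(** Makes the far hypothesis contradictory for large [eps]. By Cauchy-Schwarz over the Kraus
    operators an output entry is at most [N i a * N j b], and trace preservation makes [N] sum to
    d_in; the depolarizing part contributes at most d_in. *)
Lemma choi2_le : choi2 Phi <= 4 * din%:R ^+ 2.
Proof.
have [K [A [PhiE A1]]] := chPhi.
pose N i a := \sum_k normc2 (A k a i).
have NN : \sum_i \sum_a N i a = din%:R.
  have E k i : ((A k)^t* *m A k) i i = toC (\sum_a normc2 (A k a i)).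
    rewrite mxE rmorph_sum; apply: eq_bigr => a _.
    by rewrite adjointE mulrC /= normc2E.
  have trE : \tr (\sum_k (A k)^t* *m A k) = toC (\sum_k \sum_i \sum_a normc2 (A k a i)).
    rewrite raddf_sum rmorph_sum; apply: eq_bigr => k _ /=.
    by rewrite /mxtrace rmorph_sum; apply: eq_bigr => i _; exact: E.
  apply: complexI; rewrite rmorph_nat -(mxtrace1 C) -A1 trE /N; congr toC.
  rewrite [RHS]exchange_big; apply: eq_bigr => i _ /=.
  by rewrite exchange_big.
have PhiN i j a b : normc2 (Phi (delta_mx i j) a b) <= N i a * N j b.
  have -> : Phi (delta_mx i j) a b = \sum_k A k a i * (A k b j)^*.
    rewrite PhiE summxE; apply: eq_bigr => k _.
    rewrite -(mul_delta_mx (0 : 'I_1)) mulmxA -mulmxA -colE -rowE.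
    by rewrite mxE big_ord1 !mxE.
  apply: le_trans (normc2_cauchy_schwarz _ _) _.
  by under [X in _ * X <= _]eq_bigr => k _ do rewrite normc2_conj.
have dR : 1 <= dout%:R :> R by rewrite ler1n.
have nR : 1 <= din%:R :> R by rewrite ler1n.
have DN i j a b : normc2 (@depolarizing R din dout (delta_mx i j) a b) <=
    dout%:R^-1 * ((i == j)%:R * (a == b)%:R).
  have trd : \tr (delta_mx i j : 'M[C]_din) = (i == j)%:R.
    rewrite /mxtrace (bigD1 i) //= mxE eqxx big1 ?addr0 // => k ki.
    by rewrite mxE (negPf ki).
  rewrite /depolarizing mxE trd.
  have [_|_] := eqVneq i j; have [_|_] := eqVneq a b;
    rewrite ?mulr0n ?mul0r ?mul0rn /normc2 ?expr0n ?addr0 ?mul0r ?mulr0 //=.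
  rewrite mulr1n -/(normc2 _) mul1r mul1r -(rmorph_nat toC) -fmorphV normc2_real.
  by rewrite expr2 mulr1 ler_piMr ?invr_ge0 ?ler0n // invf_le1 // ltr0n.
have Dsum : \sum_(i < din) \sum_(j < din) \sum_(a < dout) \sum_(b < dout)
    dout%:R^-1 * ((i == j)%:R * (a == b)%:R) = din%:R :> R.
  have delta (m : nat) (i : 'I_m) : \sum_(j < m) (i == j)%:R = 1 :> R.
    by rewrite (bigD1 i) //= eqxx big1 ?addr0 // => j; rewrite eq_sym => /negPf ->.
  under eq_bigr => i _ do under eq_bigr => j _ do under eq_bigr => a _ do
    rewrite -!mulr_sumr delta mulr1.
  under eq_bigr => i _ do under eq_bigr => j _ do
    rewrite sumr_const card_ord -(mulr_natr (_ * _)) mulrAC mulVf ?mul1r ?pnatr_eq0 -?lt0n //.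
  under eq_bigr => i _ do rewrite delta.
  by rewrite sumr_const card_ord.
apply: (@le_trans _ _ (\sum_i \sum_j \sum_a \sum_b (2 * (N i a * N j b) +
   2 * (dout%:R^-1 * ((i == j)%:R * (a == b)%:R))))).
  apply: ler_sum => i _; apply: ler_sum => j _; apply: ler_sum => a _.
  apply: ler_sum => b _; rewrite /disc !mxE.
  apply: le_trans (normc2B_le _ _) _.
  have := PhiN i j a b; have := DN i j a b; rewrite !mxE; lra.
have NNE : \sum_i \sum_j \sum_a \sum_b N i a * N j b = din%:R ^+ 2.
  rewrite expr2 -[in RHS]NN mulr_suml; apply: eq_bigr => i _.
  rewrite exchange_big mulr_suml; apply: eq_bigr => a _ /=.
  rewrite mulr_sumr; apply: eq_bigr => j _.
  by rewrite mulr_sumr.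
have -> : \sum_i \sum_j \sum_a \sum_b (2 * (N i a * N j b) +
   2 * (dout%:R^-1 * ((i == j)%:R * (a == b)%:R))) = 2 * din%:R ^+ 2 + 2 * din%:R.
  rewrite -[in X in X + _]NNE -[in X in _ + X]Dsum !mulr_sumr -big_split.
  apply: eq_bigr => i _; rewrite !mulr_sumr -big_split.
  apply: eq_bigr => j _; rewrite !mulr_sumr -big_split.
  apply: eq_bigr => a _; rewrite !mulr_sumr -big_split.
  by [].
nra.
Qed.

End Choi.

(** * Moments of the block test *)

Section BlockTest.
Context {R : realFieldType}.

Lemma expect_pair {S T : finType} (q : S -> R) (r : S -> T -> R) (F : S * T -> R) :
  expect (fun st => q st.1 * r st.1 st.2) F =
  expect q (fun s => expect (r s) (fun t => F (s, t))).
Proof.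
rewrite /expect sum_pairE; apply: eq_bigr => s _.
by rewrite mulr_sumr; apply: eq_bigr => t _; rewrite mulrA.
Qed.

Lemma expect_recenter {T : finType} (q F : T -> R) (s a : R) :
  \sum_t q t = 1 -> expect q F = s ->
  expect q (fun t => (F t - a) ^+ 2) = expect q (fun t => (F t - s) ^+ 2) + (s - a) ^+ 2.
Proof. by move=> q1 Fs; rewrite !expect_sqrB // Fs; ring. Qed.

Lemma unif_pweight {J T : finType} (w : {ffun J -> T}) :
  unif w = pweight (fun=> unif) w :> R.
Proof. by rewrite /pweight /unif prodr_const card_ffun natrX exprVn. Qed.

Lemma sum_sqr_le {I : finType} (x : I -> R) :
  (forall i, 0 <= x i) -> \sum_i x i ^+ 2 <= (\sum_i x i) ^+ 2.
Proof.
move=> x0; rewrite expr2 mulr_suml; apply: ler_sum => i _.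
by rewrite expr2 ler_wpM2l // (bigD1 i) //= lerDl sumr_ge0.
Qed.

Context {Om T Z : finType} (k m : nat) (p : Om -> T -> Z -> R).
Hypothesis p0 : forall om t z, 0 <= p om t z.
Hypothesis p1 : forall om t, \sum_z p om t z = 1.
Context (om0 : Om) (z0 : Z).

Let K : R := k%:R.
Let M : R := m%:R.
Let c : R := #|Z|%:R^-1.

Definition block_signal (om : Om) : R := \sum_t \sum_z (p om t z - c) ^+ 2.
Let G := block_signal.
Let mu := expect unif G.

Definition block_law (w : {ffun 'I_k -> Om}) (b : 'I_k * T) : Z -> R := p (w b.1) b.2.
Definition sample_law w : {ffun ('I_k * T) * 'I_m -> Z} -> R :=
  pweight (fun j => block_law w j.1).
Definition joint_law : {ffun 'I_k -> Om} *
    ({ffun ('I_k * T) * 'I_m -> Z} * {ffun ('I_k * T) * 'I_m -> Z}) -> R :=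
  fun t => unif t.1 * (sample_law t.1 t.2.1 * sample_law t.1 t.2.2).

Let sum_unif_ffun : \sum_(w : {ffun 'I_k -> Om}) unif w = 1 :> R.
Proof. exact: (unif1 [ffun=> om0]). Qed.

Let sample_law1 w : \sum_f sample_law w f = 1.
Proof. by apply: pweight1 => j; exact: p1. Qed.

Lemma joint_law_ge0 t : 0 <= joint_law t.
Proof.
rewrite /joint_law; apply: mulr_ge0; first exact: unif_ge0.
by apply: mulr_ge0; apply: pweight_ge0 => j z; exact: p0.
Qed.

Let pair_law1 w : \sum_fg sample_law w fg.1 * sample_law w fg.2 = 1.
Proof.
rewrite sum_pairE -[RHS](sample_law1 w); apply: eq_bigr => f _ /=.
by rewrite -mulr_sumr sample_law1 mulr1.
Qed.

Lemma joint_law1 : \sum_t joint_law t = 1.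
Proof.
rewrite sum_pairE -[RHS]sum_unif_ffun; apply: eq_bigr => w _ /=.
by rewrite -mulr_sumr pair_law1 mulr1.
Qed.

Let expect_unif_sum (F : Om -> R) :
  expect unif (fun w : {ffun 'I_k -> Om} => \sum_i F (w i)) = K * expect unif F.
Proof.
rewrite expect_sum (eq_bigr (fun=> expect unif F)) ?sumr_const ?card_ord ?mulr_natl //.
move=> i _; transitivity (expect (pweight (fun=> unif)) (fun w : {ffun 'I_k -> Om} => F (w i))).
  by apply: eq_bigr => w _; rewrite unif_pweight.
by apply: expect_coord => j; exact: (unif1 om0).
Qed.

Let mulrnK (x : R) : x *+ k = K * x.
Proof. by rewrite mulr_natl. Qed.

(** The seeds are independent, so the variance of the sum is [K] times that of one; the subtracted
    squared mean is dropped. *)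
Let var_signal_sum :
  expect unif (fun w : {ffun 'I_k -> Om} => (\sum_i G (w i) - K * mu) ^+ 2) <=
  K * expect unif (fun om => G om ^+ 2).
Proof.
have -> : expect unif (fun w : {ffun 'I_k -> Om} => (\sum_i G (w i) - K * mu) ^+ 2) =
    K * (expect unif (fun om => G om ^+ 2) - mu ^+ 2).
  rewrite expect_sqrB // expect_unif_sum -/mu.
  have -> : expect unif (fun w : {ffun 'I_k -> Om} => (\sum_i G (w i)) ^+ 2) =
      K * (expect unif (fun om => G om ^+ 2) - mu ^+ 2) + (K * mu) ^+ 2.
    transitivity (expect (pweight (fun=> unif)) (fun w : {ffun 'I_k -> Om} =>
        (\sum_i G (w i)) * (\sum_i G (w i)))).
      by apply: eq_bigr => w _; rewrite unif_pweight expr2.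
    rewrite (expect_sum_mul _ _ (fun=> G) (fun=> G)); last by move=> j; exact: (unif1 om0).
    rewrite !sumr_const card_ord -/mu !mulrnK -expr2.
    by congr (K * (_ - _) + _); apply: eq_expect => om; rewrite expr2.
  by ring.
by apply: ler_wpM2l; rewrite ?ler0n // lerBlDr lerDl sqr_ge0.
Qed.

Let d0 : #|Z|%:R != 0 :> R.
Proof. by rewrite pnatr_eq0 -lt0n; apply/card_gt0P; exists z0. Qed.

Let sum_deviations w :
  \sum_(a : ('I_k * T) * Z) (block_law w a.1 a.2 - c) ^+ 2 = \sum_i G (w i).
Proof. by rewrite !sum_pairE. Qed.

Let sum_squares w : \sum_(a : ('I_k * T) * Z) block_law w a.1 a.2 ^+ 2 =
  K * #|T|%:R * c + \sum_i G (w i).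
Proof.
have -> : K * #|T|%:R * c = \sum_(i < k) \sum_(t : T) c.
  by rewrite !sumr_const card_ord mulrnK -(mulr_natl c) mulrA.
rewrite !sum_pairE -big_split; apply: eq_bigr => i _.
rewrite -big_split; apply: eq_bigr => t _ /=.
rewrite [X in _ = _ + X](eq_bigr (fun z => (p (w i) t z ^+ 2 + (- 2 * c) * p (w i) t z) + c ^+ 2)); last first.
  by move=> z _; ring.
rewrite !big_split /= -mulr_sumr p1 sumr_const -(mulr_natl (c ^+ 2)).
have -> : #|Z|%:R * c ^+ 2 = c by rewrite /c; field.
by rewrite /block_law /=; ring.
Qed.

(** With x the deviation from [c], the summand is c x^2 + x^3, and x^3 <= (lam / 2) x^2 + x^4 / (2
    lam). The free parameter [lam] replaces a Cauchy-Schwarz step with square roots and is optimized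
    later. *)
Let sum_cubes w lam : 0 < lam ->
  \sum_(a : ('I_k * T) * Z) block_law w a.1 a.2 * (block_law w a.1 a.2 - c) ^+ 2 <=
  c * (\sum_i G (w i)) + (lam / 2 * (\sum_i G (w i)) + (2 * lam)^-1 * (\sum_i G (w i) ^+ 2)).
Proof.
move=> lam0.
apply: (@le_trans _ _ (\sum_(a : ('I_k * T) * Z) ((c + lam / 2) * (block_law w a.1 a.2 - c) ^+ 2
   + (2 * lam)^-1 * ((block_law w a.1 a.2 - c) ^+ 2) ^+ 2))).
  apply: ler_sum => a _; set x := block_law w a.1 a.2 - c.
  have -> : block_law w a.1 a.2 = x + c by rewrite /x; ring.
  have lamn : lam != 0 by rewrite gt_eqF.
  rewrite -subr_ge0 (_ : _ - _ = (2 * lam)^-1 * (lam * x - x ^+ 2) ^+ 2); last by field.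
  by rewrite mulr_ge0 ?sqr_ge0 // invr_ge0 mulr_ge0 // ltW.
rewrite big_split /= -!mulr_sumr sum_deviations mulrDl -addrA lerD2l lerD2l.
apply: ler_wpM2l; first by rewrite invr_ge0 mulr_ge0 // ltW.
rewrite sum_pairE sum_pairE; apply: ler_sum => i _.
have := sum_sqr_le (fun a : T * Z => (p (w i) a.1 a.2 - c) ^+ 2) (fun a => sqr_ge0 _).
by rewrite !sum_pairE.
Qed.

(** Conditioning on the seeds splits the deviation into the sampling variance, which gives the terms
    in M^2 and M^3, and the fluctuation of the conditional mean over the seeds, which gives the term
    in M^4. *)
Lemma block_test_second_moment lam H : 0 < lam ->
  expect unif (fun om => G om ^+ 2) <= H * mu ^+ 2 ->
  expect joint_law (fun t => (collisions c t.2.1 t.2.2 - M ^+ 2 * (K * mu)) ^+ 2) <=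
  2 * M ^+ 2 * (K * #|T|%:R * c + K * mu) + 2 * M ^+ 3 * (c * (K * mu))
  + M ^+ 3 * (lam * (K * mu) + lam^-1 * (K * (H * mu ^+ 2))) + M ^+ 4 * (K * (H * mu ^+ 2)).
Proof.
move=> lam0 HG; rewrite /joint_law (expect_pair unif (fun w fg => sample_law w fg.1 * sample_law w fg.2)).
have K0 : 0 <= K by rewrite ler0n.
have M0 : 0 <= M by rewrite ler0n.
apply: (@le_trans _ _ (expect unif (fun w : {ffun 'I_k -> Om} =>
    2 * M ^+ 2 * (K * #|T|%:R * c) + ((2 * M ^+ 2 + 2 * M ^+ 3 * c + M ^+ 3 * lam) * (\sum_i G (w i))
    + (M ^+ 3 * lam^-1 * (\sum_i G (w i) ^+ 2)
       + M ^+ 4 * (\sum_i G (w i) - K * mu) ^+ 2))))).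
  apply: ler_expect => w; first exact: unif_ge0.
  have mean : expect (fun fg => sample_law w fg.1 * sample_law w fg.2)
      (fun fg => collisions c fg.1 fg.2) = M ^+ 2 * \sum_i G (w i).
    rewrite (expect_pair (sample_law w) (fun=> sample_law w)).
    have := mean_collisions c (block_law w) (fun b => p1 _ _) (M := 'I_m).
    by rewrite card_ord sum_deviations.
  rewrite (expect_recenter _ _ _ _ (pair_law1 w) mean).
  have := var_collisions c (block_law w) (fun b z => p0 _ _ z) (fun b => p1 _ _) (M := 'I_m).
  rewrite card_ord sum_deviations sum_squares -/M.
  rewrite (expect_pair (sample_law w) (fun=> sample_law w)) => /= le1.
  have le2 := ler_wpM2l (exprn_ge0 3 M0) (sum_cubes w lam lam0).
  have -> : (M ^+ 2 * \sum_i G (w i) - M ^+ 2 * (K * mu)) ^+ 2 =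
    M ^+ 4 * (\sum_i G (w i) - K * mu) ^+ 2 by ring.
  move: le1 le2; rewrite invfM; set E := expect _ _; set S1 := \sum_i _; set S2 := \sum_i _.
  set S3 := \sum_a _; set Q := (S1 - _) ^+ 2; lra.
rewrite !expectD !expectZ expect_cst // (expect_unif_sum G).
rewrite (expect_unif_sum (fun om => G om ^+ 2)) -/mu.
have le1 := ler_wpM2l (exprn_ge0 4 M0) (le_trans var_signal_sum (ler_wpM2l K0 HG)).
have le2 : M ^+ 3 * lam^-1 * (K * expect unif (fun om => G om ^+ 2)) <=
    M ^+ 3 * lam^-1 * (K * (H * mu ^+ 2)).
  apply: ler_wpM2l; last exact: ler_wpM2l.
  by rewrite mulr_ge0 ?exprn_ge0 // invr_ge0 ltW.
lra.
Qed.

End BlockTest.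

(** * The algorithm *)

Section UniformNat.
Context {R : realType} (n : nat).

(** Uniform on the [n.+1] points 0, ..., n. Using [nat] as the seed space makes the measurability
    fields of an algorithm trivial; [decode] then reads a seed off the number. *)
Definition unif_nat : set nat -> \bar R :=
  msum (fun i => mscale ((n.+1%:R^-1)%:nng : {nonneg R}) (dirac i)) n.+1.

HB.instance Definition _ := Measure.on unif_nat.

Let unif_natT : unif_nat [set: nat] = 1%E.
Proof.
rewrite /unif_nat /msum /= /mscale /=.
under eq_bigr => i _ do rewrite diracT mule1.
rewrite sumEFin sumr_const card_ord -mulr_natr mulVf ?pnatr_eq0 //.
Qed.

HB.instance Definition _ := Measure_isProbability.Build _ _ R unif_nat unif_natT.

Lemma integral_unif_nat (f : nat -> R) : (forall x, 0 <= f x) ->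
  (\int[unif_nat]_y (f y)%:E)%E = (\sum_(i < n.+1) n.+1%:R^-1 * f i)%:E.
Proof.
move=> f0; rewrite /unif_nat ge0_integral_measure_sum //=; last by move=> x _; rewrite lee_fin.
rewrite -sumEFin; apply: eq_bigr => i _.
rewrite ge0_integral_mscale //=; last by move=> x _; rewrite lee_fin.
by rewrite integral_dirac //= diracT mul1e EFinM.
Qed.

End UniformNat.

Section SeededAlgorithm.
Context {R : realType} {T : finType} (t0 : T).

Definition decode (i : nat) : T := nth t0 (enum T) i.

Lemma integral_unif_decode (f : T -> R) : (forall t, 0 <= f t) ->
  (\int[unif_nat #|T|.-1]_y (f (decode y))%:E)%E = (expect unif f)%:E.
Proof.
move=> f0; rewrite integral_unif_nat //.
have T0 : (0 < #|T|)%N by apply/card_gt0P; exists t0.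
congr _%:E; rewrite /expect /unif prednK // -!mulr_sumr; congr (_ * _).
rewrite -[RHS]big_enum (big_nth t0) -cardE big_mkord /= /decode.
by apply: eq_bigr.
Qed.

End SeededAlgorithm.

Section BlockAlgorithm.
Context {R : realType} {din dout : nat}.
Local Notation C := R[i].
Local Notation bits n := {ffun 'I_n * bool -> bool}.
Context (z : C) (din0 : (0 < din)%N) (zP : dout.-primitive_root z) (k m : nat) (theta : R).

Local Notation block := ('I_k.+1 * (bool * bool))%type.
Local Notation slot := (bool * (block * 'I_m))%type.
Local Notation samples := {ffun block * 'I_m -> 'I_dout}.
Local Notation seeds := {ffun 'I_k.+1 -> bits din * bits dout}.
Local Notation N := #|{: slot}|.

Definition default_seed : seeds := [ffun=> ([ffun=> true], [ffun=> true])].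

(** The schedule is not adaptive: only the length of the history matters, as the position in the
    enumeration of slots. The default serves histories longer than any that occurs. *)
Definition block_at (h : seq 'I_dout) : block :=
  oapp (fun t : 'I_N => (enum_val t).2.1) (ord0, (true, true)) (insub (size h)).

Definition input_at (w : nat) (h : seq 'I_dout) : 'M[C]_din :=
  probe (block_at h).2.1 (decode default_seed w (block_at h).1).1.

Definition meas_at (w : nat) (h : seq 'I_dout) (x : 'I_dout) : 'M[C]_dout :=
  basis_meas z (block_at h).2.2 (decode default_seed w (block_at h).1).2 x.

Definition half (x : N.-tuple 'I_dout) (e : bool) : samples :=
  [ffun j => tnth x (enum_rank (e, j))].

Definition accepts (fg : samples * samples) : bool :=
  collisions (dout%:R^-1 : R) fg.1 fg.2 < theta.

Definition block_algorithm : algorithm R din dout N.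
Proof.
refine (@Algorithm R din dout N _ nat (unif_nat #|{: seeds}|.-1) 'I_dout
  input_at meas_at (fun _ x => accepts (half x true, half x false)) _ _ _ _ _).
- by move=> w h; exact: probe_state.
- by move=> w h; exact: basis_meas_povm.
- by move=> h i j.
- by move=> h x i j.
- by [].
Defined.

Context (Phi : 'M[C]_din -> 'M[C]_dout) (chPhi : is_channel Phi).

Definition channel_law (om : bits din * bits dout) (rq : bool * bool) (y : 'I_dout) : R :=
  outcome_prob Phi z (probe rq.1 om.1) rq.2 om.2 y.

Lemma channel_law_ge0 om rq y : 0 <= channel_law om rq y.
Proof. by apply: (outcome_prob_ge0 _ _ chPhi); exact: probe_state. Qed.

Lemma sum_channel_law om rq : \sum_y channel_law om rq y = 1.
Proof. by apply: (sum_outcome_prob _ _ chPhi zP); exact: probe_state. Qed.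

Let law (w : seeds) : samples -> R := sample_law k.+1 m channel_law w.

(** As inputs and bases depend on the position alone, the step probabilities multiply to a product
    over slots, which splits along the group bit. *)
Lemma block_transcript_prob (w : nat) (x : N.-tuple 'I_dout) :
  @transcript_prob R din dout N block_algorithm Phi w x =
  law (decode default_seed w) (half x true) * law (decode default_seed w) (half x false).
Proof.
set om := decode default_seed w.
transitivity (\prod_(s : slot) block_law k.+1 channel_law om s.2.1 (tnth x (enum_rank s))).
  rewrite (reindex (@enum_val _ (mem {: slot}))) /=; last first.
    exact: (onW_bij _ (@enum_val_bij _)).
  apply: eq_bigr => t _; rewrite enum_valK.
  have <- : block_at (take t x) = (enum_val t).2.1.
    rewrite /block_at size_takel ?size_tuple; last exact: ltnW.
    by rewrite valK.
  by [].
rewrite /law /sample_law /pweight.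
transitivity (\prod_(e : bool) \prod_(j : block * 'I_m)
    block_law k.+1 channel_law om j.1 (tnth x (enum_rank (e, j)))).
  by rewrite pair_bigA; apply: eq_bigr => -[].
by rewrite big_bool; congr (_ * _); apply: eq_bigr => j _; rewrite ffunE.
Qed.

Lemma sum_halves (P : pred (samples * samples)) (F : samples * samples -> R) :
  \sum_(x : N.-tuple 'I_dout | P (half x true, half x false)) F (half x true, half x false) =
  \sum_(fg | P fg) F fg.
Proof.
symmetry; apply: (reindex (fun x : N.-tuple 'I_dout => (half x true, half x false))) => /=.
exists (fun fg : samples * samples =>
  [tuple (let s := enum_val t in (if s.1 then fg.1 else fg.2) s.2) | t < N]) => [x _|[f g] _] /=.
  apply: eq_from_tnth => t; rewrite tnth_mktuple.
  case E : (enum_val t) => [e j] /=.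
  have -> : (if e then half x true else half x false) j = tnth x (enum_rank (e, j)).
    by case: (e); rewrite ffunE.
  by rewrite -E enum_valK.
by congr (_, _); apply/ffunP => j; rewrite ffunE tnth_mktuple enum_rankK.
Qed.

Lemma block_verdict_prob (b : bool) :
  verdict_prob block_algorithm Phi b =
  (\sum_(t | accepts t.2 == b) joint_law k.+1 m channel_law t)%:E.
Proof.
have law_ge0 w f : 0 <= law w f.
  by apply: pweight_ge0 => j y; exact: channel_law_ge0.
pose F (w : seeds) : R := \sum_(fg | accepts fg == b) law w fg.1 * law w fg.2.
transitivity (\int[unif_nat #|{: seeds}|.-1]_y (F (decode default_seed y))%:E)%E.
  apply: eq_integral => w _; congr _%:E.
  rewrite /F -(sum_halves (fun fg => accepts fg == b)).
  by apply: eq_bigr => x _; rewrite block_transcript_prob.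
rewrite integral_unif_decode => [|w]; last first.
  by apply: sumr_ge0 => fg _; exact: mulr_ge0.
congr _%:E; rewrite big_mkcond sum_pairE /expect; apply: eq_bigr => w _ /=.
by rewrite -big_mkcond /F mulr_sumr.
Qed.

End BlockAlgorithm.

(** * Guarantees *)

Lemma ler_sqr_half {R : realFieldType} (a x : R) :
  0 <= a -> x <= a / 2 -> (a / 2) ^+ 2 <= (x - a) ^+ 2.
Proof.
move=> a0 xa; rewrite -[(x - a) ^+ 2]sqrrN opprB.
by rewrite ler_sqr ?nnegrE; lra.
Qed.

Lemma nat_above {R : realType} (x : R) : 0 <= x -> exists k, x <= k.+1%:R.
Proof.
by move=> /truncn_itv/andP[_ lt]; exists (Num.truncn x); exact: ltW.
Qed.

(** With Y = M^2 mu, v = Y^2 K and g = K v, the allowance is g / 12 = 6 g / 72. The weight M mu K /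
    72 makes one interference term exactly g / 72, the fluctuation of the seeds costs at most
    another g / 72, and the rest is at most 27 v / 8, with v <= g / 72. *)
Lemma variance_budget {R : realFieldType} (K M mu c H : R) :
  0 < K -> 0 < M -> 0 < mu -> 0 < c -> c <= 1 -> 1 <= H -> 72 * H <= K ->
  8 * c <= M ^+ 2 * mu ^+ 2 -> 8 <= M ^+ 2 * mu ->
  2 * M ^+ 2 * (K * 4 * c + K * mu) + 2 * M ^+ 3 * (c * (K * mu))
  + M ^+ 3 * (M * mu * K / 72 * (K * mu) + (M * mu * K / 72)^-1 * (K * (H * mu ^+ 2)))
  + M ^+ 4 * (K * (H * mu ^+ 2)) <=
  3^-1 * (M ^+ 2 * (K * mu) / 2) ^+ 2.
Proof.
have fin (x1 x3 x5 x6 u v g : R) : x1 <= v -> 8 * u <= v -> x3 <= 2 * v -> x5 <= u ->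
    72 * x6 <= g -> 72 * v <= g -> 0 <= v ->
    x1 + 2 * u + x3 + (g / 72 + x5) + x6 <= g / 12 by lra.
move=> K_gt0 M_gt0 mu_gt0 c_gt0 c_le1 H1 HK A X.
(* If M mu were below c <= 1, its square would be below c, against the lower bound 8 c. *)
have c_le : c <= M * mu.
  have p_ge0 : 0 <= M * mu by rewrite mulr_ge0 // ltW.
  have Ap : 8 * c <= (M * mu) * (M * mu) by rewrite -expr2 exprMn.
  move: p_ge0 Ap; set x := M * mu => p_ge0 Ap; clear -c_gt0 c_le1 p_ge0 Ap; nra.
pose Y := M ^+ 2 * mu.
have Y8 : 8 <= Y := X.
have Y0 : 0 <= Y by apply: le_trans Y8; rewrite ler0n.
have Kge := ltW K_gt0; have Mge := ltW M_gt0; have muge := ltW mu_gt0.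
have H0 : 0 <= H by apply: le_trans H1; rewrite ler01.
pose u := Y * K; pose v := Y ^+ 2 * K; pose g := K * v.
have v0 : 0 <= v by rewrite mulr_ge0 ?sqr_ge0.
have t1 : M ^+ 2 * K * (8 * c) <= v.
  rewrite (_ : v = M ^+ 2 * K * (M ^+ 2 * mu ^+ 2)); last by rewrite /v /Y; ring.
  by apply: ler_wpM2l => //; rewrite mulr_ge0 ?sqr_ge0.
have t2 : 8 * u <= v.
  rewrite (_ : v = Y * u); last by rewrite /v /u; ring.
  by apply: ler_wpM2r => //; rewrite mulr_ge0.
have t3 : 2 * M ^+ 3 * (c * (K * mu)) <= 2 * v.
  rewrite (_ : 2 * v = 2 * M ^+ 3 * ((M * mu) * (K * mu))); last by rewrite /v /Y; ring.
  apply: ler_wpM2l; first by rewrite mulr_ge0 ?exprn_ge0.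
  by apply: ler_wpM2r => //; rewrite mulr_ge0.
have t4 : M ^+ 3 * (M * mu * K / 72 * (K * mu)) = g / 72 by rewrite /g /v /Y; field.
have t5 : M ^+ 3 * ((M * mu * K / 72)^-1 * (K * (H * mu ^+ 2))) <= u.
  have -> : M ^+ 3 * ((M * mu * K / 72)^-1 * (K * (H * mu ^+ 2))) = Y * (72 * H).
    by rewrite /Y; field; rewrite !gt_eqF.
  exact: ler_wpM2l.
have t6 : 72 * (M ^+ 4 * (K * (H * mu ^+ 2))) <= g.
  have -> : 72 * (M ^+ 4 * (K * (H * mu ^+ 2))) = (72 * H) * v by rewrite /v /Y; ring.
  exact: ler_wpM2r.
have t7 : 72 * v <= g.
  by apply: ler_wpM2r => //; apply: le_trans HK; rewrite ler_peMr ?ler0n.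
have -> : 3^-1 * (M ^+ 2 * (K * mu) / 2) ^+ 2 = g / 12 by rewrite /g /v /Y; field.
have -> : 2 * M ^+ 2 * (K * 4 * c + K * mu) = M ^+ 2 * K * (8 * c) + 2 * u.
  by rewrite /u /Y; ring.
rewrite [M ^+ 3 * (_ + _)]mulrDr t4.
exact: fin t1 t2 t3 t5 t6 t7 v0.
Qed.

Section Guarantees.
Context {R : realType} {din dout : nat}.
Local Notation C := R[i].
Local Notation bits n := {ffun 'I_n * bool -> bool}.
Context (z : C) (din0 : (0 < din)%N) (zP : dout.-primitive_root z) (k m : nat) (theta : R).
Context (Phi : 'M[C]_din -> 'M[C]_dout) (chPhi : is_channel Phi).

Let K : R := k.+1%:R.
Let M : R := m%:R.
Let d : R := dout%:R.

Let dout0 : (0 < dout)%N.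
Proof. exact: prim_order_gt0 zP. Qed.

Let block_signalE (om : bits din * bits dout) :
  block_signal (channel_law z Phi) om = signal Phi z om.1 om.2.
Proof. by rewrite /block_signal sum_pairE card_ord. Qed.

Let mean_blockE : expect unif (block_signal (channel_law z Phi)) = mean_signal Phi z.
Proof. exact: eq_expect block_signalE. Qed.

Let deviation_bound lam H : 0 < lam ->
  expect unif (fun om => block_signal (channel_law z Phi) om ^+ 2) <=
    H * mean_signal Phi z ^+ 2 ->
  expect (joint_law k.+1 m (channel_law z Phi))
    (fun t => (collisions d^-1 t.2.1 t.2.2 - M ^+ 2 * (K * mean_signal Phi z)) ^+ 2) <=
  2 * M ^+ 2 * (K * 4 * d^-1 + K * mean_signal Phi z)
  + 2 * M ^+ 3 * (d^-1 * (K * mean_signal Phi z))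
  + M ^+ 3 * (lam * (K * mean_signal Phi z) + lam^-1 * (K * (H * mean_signal Phi z ^+ 2)))
  + M ^+ 4 * (K * (H * mean_signal Phi z ^+ 2)).
Proof.
move=> lam0 H2; rewrite -mean_blockE.
have := block_test_second_moment k.+1 m (channel_law z Phi)
  (channel_law_ge0 z din0 Phi chPhi) (sum_channel_law z din0 zP Phi chPhi)
  ([ffun=> true], [ffun=> true]) (Ordinal dout0) lam H lam0.
rewrite card_ord card_prod !card_bool; apply.
by rewrite mean_blockE.
Qed.

Lemma depolarizing_guarantee : Phi =1 @depolarizing R din dout -> 0 < theta ->
  8 * M ^+ 2 * K * d^-1 <= 3^-1 * theta ^+ 2 ->
  ((2 / 3 : R)%:E <= verdict_prob (block_algorithm z din0 zP k m theta) Phi true)%E.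
Proof.
move=> PhiE theta0 bound.
have signal0 (om : bits din * bits dout) : signal Phi z om.1 om.2 = 0.
  do 3 (apply: big1 => ? _); rewrite (outcome_probB _ _ zP) //; last exact: probe_state.
  by rewrite /disc PhiE subrr mul0mx mxtrace0 expr0n.
have mean0 : mean_signal Phi z = 0.
  by apply: big1 => om _; rewrite signal0 mulr0.
have second0 : expect unif (fun om => block_signal (channel_law z Phi) om ^+ 2) <=
    0 * mean_signal Phi z ^+ 2.
  by rewrite mul0r /expect big1 // => om _; rewrite block_signalE signal0 expr0n mulr0.
(* The signal vanishes, so [H = 0] is admissible and any [lam] will do; only the counting noise 8
   M^2 K / d survives. *)
have dev := deviation_bound 1 0 ltr01 second0.
rewrite block_verdict_prob // lee_fin.
have -> : 2 / 3 = 1 - 3^-1 :> R by field.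
apply: (chebyshev_finite _ (fun t => collisions d^-1 t.2.1 t.2.2)
  _ (M ^+ 2 * (K * mean_signal Phi z)) _ (theta ^+ 2)).
- by move=> t; apply: joint_law_ge0; exact: channel_law_ge0.
- by apply: joint_law1 => //; [exact: sum_channel_law | exact: ([ffun=> true], [ffun=> true])].
- move=> t; rewrite eqb_id /accepts -leNgt mean0 !mulr0 subr0 => le_theta.
  by rewrite ler_sqr ?nnegrE // ltW // (lt_le_trans theta0).
- apply: le_trans dev _; rewrite mean0 expr0n; lra.
- exact: exprn_gt0.
Qed.

(** The threshold can only use the known bound [mu0], half of whose predicted mean it is. A wrong
    verdict then lies at least half the true mean away from it, which matches a variance bound
    relative to the true mean. *)
Lemma far_guarantee (mu0 : R) : 0 < mu0 -> mu0 <= mean_signal Phi z ->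
  72 * 81 ^+ 2 <= K -> 8 * d^-1 <= M ^+ 2 * mu0 ^+ 2 -> 8 <= M ^+ 2 * mu0 ->
  theta = M ^+ 2 * (K * mu0) / 2 ->
  ((2 / 3 : R)%:E <= verdict_prob (block_algorithm z din0 zP k m theta) Phi false)%E.
Proof.
move=> mu00 mu_ge K_ge A0 X0 thetaE.
have mu_gt0 := lt_le_trans mu00 mu_ge; set mu := mean_signal Phi z in mu_ge mu_gt0.
have M_ge0 : 0 <= M by rewrite ler0n.
have M_gt0 : 0 < M.
  rewrite lt_neqAle M_ge0 andbT; apply/eqP => M0; move: X0.
  by rewrite -M0 expr0n mul0r lern0.
have K_gt0 : 0 < K by rewrite ltr0n.
have c_gt0 : 0 < d^-1 by rewrite invr_gt0 ltr0n.
have c_le1 : d^-1 <= 1 by rewrite invf_le1 ?ltr0n // ler1n.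
have M2_ge0 := sqr_ge0 M.
have A : 8 * d^-1 <= M ^+ 2 * mu ^+ 2.
  by apply: le_trans A0 _; apply: ler_wpM2l => //; rewrite ler_sqr ?nnegrE // ltW.
have X : 8 <= M ^+ 2 * mu by apply: le_trans X0 _; exact: ler_wpM2l.
pose lam := M * mu * K / 72.
have lam_gt0 : 0 < lam by rewrite /lam divr_gt0 // !mulr_gt0.
have second : expect unif (fun om => block_signal (channel_law z Phi) om ^+ 2) <=
    81 ^+ 2 * mean_signal Phi z ^+ 2.
  rewrite (eq_expect _ _ (fun om => signal Phi z om.1 om.2 ^+ 2)).
    exact: second_signal.
  by move=> om; rewrite block_signalE.
have dev := deviation_bound lam _ lam_gt0 second.
rewrite block_verdict_prob // lee_fin.
have -> : 2 / 3 = 1 - 3^-1 :> R by field.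
have mean_gt0 : 0 < M ^+ 2 * (K * mu) by rewrite !mulr_gt0.
apply: (chebyshev_finite _ (fun t => collisions d^-1 t.2.1 t.2.2)
  _ (M ^+ 2 * (K * mu)) _ ((M ^+ 2 * (K * mu) / 2) ^+ 2)).
- by move=> t; apply: joint_law_ge0; exact: channel_law_ge0.
- by apply: joint_law1 => //; [exact: sum_channel_law | exact: ([ffun=> true], [ffun=> true])].
- move=> t; rewrite eqbF_neg negbK /accepts thetaE => /ltW lt_theta.
  apply: ler_sqr_half; first exact: ltW.
  apply: le_trans lt_theta _; apply: ler_wpM2r; first by rewrite invr_ge0 ler0n.
  by apply: ler_wpM2l => //; apply: ler_wpM2l => //; exact: ltW.
- apply: le_trans dev _; apply: variance_budget => //.
  by apply: exprn_ege1; rewrite ler1n.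
- by rewrite exprn_gt0 // divr_gt0.
Qed.

End Guarantees.

Theorem theorem4p4 (R : realType) :
  exists C : R, 0 < C /\
    forall (din dout : nat) (eps : R),
      (1 <= din)%N -> (1 <= dout)%N -> 0 < eps ->
      exists (N : nat) (A : algorithm R din dout N),
        N%:R <= C * (din%:R ^+ 2 * dout%:R `^ (3 / 2)) / eps ^+ 2 /\
        forall Phi : 'M[R[i]]_din -> 'M[R[i]]_dout,
          is_channel Phi ->
          (Phi =1 @depolarizing R din dout ->
             ((2 / 3 : R)%:E <= verdict_prob A Phi true)%E) /\
          (eps <= diamond_dist Phi (@depolarizing R din dout) ->
             ((2 / 3 : R)%:E <= verdict_prob A Phi false)%E).
Proof.
(* The number of measurements is 8 K m: two groups, four tests, K seeds. With m <= 12 Q + 1 and 1 <=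
   4 Q this is at most 128 K Q. *)
have size_bound (K M Q : R) : K * M <= K * (12 * Q + 1) -> K * 1 <= K * (4 * Q) ->
    8 * K * M <= 128 * K * Q by lra.
have [k K_ge] := nat_above (72 * 81 ^+ 2 : R) (mulr_ge0 (ler0n R 72) (exprn_ge0 2 (ler0n R 81))).
have K_gt0 : 0 < k.+1%:R :> R by rewrite ltr0n.
exists (128 * k.+1%:R); split; first by rewrite mulr_gt0.
move=> din dout eps din0 dout0 eps0.
have [z zP] := @primitive_root_exists R dout dout0.
set n : R := din%:R; set d : R := dout%:R.
have n1 : 1 <= n by rewrite ler1n.
have d1 : 1 <= d by rewrite ler1n.
have n_gt0 : 0 < n by lra.
have d_gt0 : 0 < d by lra.
pose Q : R := n ^+ 2 * d `^ (3 / 2) / eps ^+ 2.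
have Q_ge0 : 0 <= Q by rewrite divr_ge0 ?sqr_ge0 // mulr_ge0 ?sqr_ge0 // powR_ge0.
have cardN m : #|{: bool * (('I_k.+1 * (bool * bool)) * 'I_m)}|%:R = 8 * k.+1%:R * m%:R :> R.
  by rewrite !card_prod !card_bool !card_ord !natrM; ring.
have boundE : 128 * k.+1%:R * (n ^+ 2 * d `^ (3 / 2)) / eps ^+ 2 = 128 * k.+1%:R * Q.
  by rewrite /Q !mulrA.
(* For large [eps] no channel is far, as [choi2_le] shows. The test with no samples has statistic 0
   and threshold 1, so it always accepts; rounding up to one sample could break the bound here. *)
have [eps_big|eps_small] := ltP (4 * n ^+ 2 * d) (eps ^+ 2).
  exists _, (block_algorithm z din0 zP k 0 1); split.
    by rewrite boundE cardN mulr0 mulr_ge0 // mulr_ge0 // ltW.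
  move=> Phi chPhi; split=> [PhiE|/(diamond_dist_le _ chPhi _ eps0) le_choi].
    by apply: depolarizing_guarantee => //; rewrite expr0n mulr0 !mul0r mulr_ge0 ?sqr_ge0.
  have := choi2_le _ chPhi din0 dout0; rewrite -/n => choi_le.
  have le_eps := le_trans le_choi (ler_wpM2l (ltW d_gt0) choi_le).
  by move: eps_big; rewrite ltNge mulrC le_eps.
have Q2 : Q ^+ 2 = n ^+ 4 * d ^+ 3 / eps ^+ 4.
  have -> : d ^+ 3 = (d `^ (3 / 2)) ^+ 2.
    rewrite -(powR_mulrn 2 (powR_ge0 d (3 / 2))) -powRrM -(powR_mulrn 3 (ltW d_gt0)).
    by congr (_ `^ _); field.
  by rewrite /Q; field; rewrite gt_eqF.
have /andP[m_le m_gt] := truncn_itv (mulr_ge0 (ler0n R 12) Q_ge0).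
set m := (Num.truncn (12 * Q)).+1 in m_gt.
have m_le' : m%:R <= 12 * Q + 1 by rewrite /m -natr1 lerD2r.
(* The bound on [eps] is what allows the 1 lost in rounding up [m] to be absorbed. *)
have Q_ge : 1 <= 4 * Q.
  have Q4_ge0 : 0 <= 4 * Q by rewrite mulr_ge0 ?ler0n.
  suff sq : 1 <= (4 * Q) ^+ 2 by move: sq; rewrite expr_ge1.
  have -> : (4 * Q) ^+ 2 = 16 * (n ^+ 4 * d ^+ 3) / eps ^+ 4.
    rewrite (_ : (4 * Q) ^+ 2 = 16 * Q ^+ 2); last by ring.
    by rewrite Q2 mulrA.
  rewrite ler_pdivlMr ?exprn_gt0 // mul1r (_ : eps ^+ 4 = (eps ^+ 2) ^+ 2); last by ring.
  have eps2_ge0 := sqr_ge0 eps.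
  have nd_ge0 : 0 <= 4 * n ^+ 2 * d := le_trans eps2_ge0 eps_small.
  apply: (@le_trans _ _ ((4 * n ^+ 2 * d) ^+ 2)); first by rewrite ler_sqr.
  rewrite (_ : (4 * n ^+ 2 * d) ^+ 2 = 16 * n ^+ 4 * d ^+ 2 * 1); last by ring.
  rewrite (_ : 16 * (n ^+ 4 * d ^+ 3) = 16 * n ^+ 4 * d ^+ 2 * d); last by ring.
  apply: ler_wpM2l => //; apply: mulr_ge0; last exact: sqr_ge0.
  by apply: mulr_ge0; rewrite ?ler0n // exprn_ge0 // ltW.
(* The least mean signal of a far channel: [choi2] is at least eps^2 / d, and [mean_signal_ge]
   divides by 4 n^2 d. *)
pose mu0 : R := eps ^+ 2 / (4 * n ^+ 2 * d ^+ 2).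
have den_gt0 : 0 < 4 * n ^+ 2 * d ^+ 2.
  by apply: mulr_gt0 (exprn_gt0 2 d_gt0); apply: mulr_gt0 (exprn_gt0 2 n_gt0); rewrite ltr0n.
have mu0_gt0 : 0 < mu0 by exact: divr_gt0 (exprn_gt0 2 eps0) den_gt0.
pose theta : R := m%:R ^+ 2 * (k.+1%:R * mu0) / 2.
have M_gt0 : 0 < m%:R :> R by rewrite ltr0n.
have Q_gt0 : 0 < Q by lra.
(* As mu0^2 = 1 / (16 Q^2 d), the choice m > 12 Q gives even 9 / d. *)
have A : 8 * d^-1 <= m%:R ^+ 2 * mu0 ^+ 2.
  have mu0Q : mu0 ^+ 2 = (16 * Q ^+ 2)^-1 * d^-1.
    by rewrite Q2 /mu0; field; rewrite !gt_eqF.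
  have Q16_gt0 : 0 < 16 * Q ^+ 2 by apply: mulr_gt0; [rewrite ltr0n | exact: exprn_gt0].
  rewrite mu0Q mulrA; apply: ler_wpM2r; first by rewrite invr_ge0 ltW.
  rewrite (ler_pdivlMr _ _ Q16_gt0).
  apply: (@le_trans _ _ ((12 * Q) ^+ 2)).
    rewrite -subr_ge0 (_ : _ - _ = 16 * Q ^+ 2); last by ring.
    by rewrite mulr_ge0 ?ler0n ?sqr_ge0.
  have Q12_ge0 : 0 <= 12 * Q by rewrite mulr_ge0 ?ler0n.
  by rewrite ler_sqr ?nnegrE ?Q12_ge0 ?(ltW M_gt0) // (ltW m_gt).
have X : 8 <= m%:R ^+ 2 * mu0.
  have mu0d : mu0 * d <= 1.
    rewrite /mu0 mulrAC (ler_pdivrMr _ _ den_gt0) mul1r.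
    rewrite (_ : 4 * n ^+ 2 * d ^+ 2 = 4 * n ^+ 2 * d * d); last by ring.
    by apply: ler_wpM2r => //; exact: ltW.
  have A' : 8 <= m%:R ^+ 2 * mu0 * (mu0 * d).
    have := ler_wpM2r (ltW d_gt0) A; rewrite mulfVK ?gt_eqF // => /le_trans; apply.
    by rewrite le_eqVlt; apply/orP; left; apply/eqP; ring.
  apply: le_trans A' _; rewrite ler_piMr //.
  by apply: mulr_ge0; [exact: sqr_ge0 | exact: ltW].
exists _, (block_algorithm z din0 zP k m theta); split.
  rewrite boundE cardN.
  exact: size_bound (ler_wpM2l (ltW K_gt0) m_le') (ler_wpM2l (ltW K_gt0) Q_ge).
move=> Phi chPhi; split=> [PhiE|/(diamond_dist_le _ chPhi _ eps0) le_choi].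
  apply: depolarizing_guarantee => //.
    apply: divr_gt0; last by rewrite ltr0n.
    (* After this positivity, the remaining noise bound reduces to 8 / d <= M^2 mu0^2 together with
       12 <= K. *)
    exact: mulr_gt0 (exprn_gt0 2 M_gt0) (mulr_gt0 K_gt0 mu0_gt0).
  rewrite -/d (_ : 3^-1 * theta ^+ 2 =
    (m%:R ^+ 2 * k.+1%:R) * ((m%:R ^+ 2 * mu0 ^+ 2) * (k.+1%:R / 12))); last by rewrite /theta; field.
  rewrite (_ : 8 * m%:R ^+ 2 * k.+1%:R / d = (m%:R ^+ 2 * k.+1%:R) * (8 * d^-1 * 1)); last by ring.
  apply: ler_wpM2l; first exact: mulr_ge0 (sqr_ge0 _) (ltW K_gt0).
  apply: ler_pM => //; first by apply: mulr_ge0; rewrite ?ler0n // invr_ge0 ltW.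
  rewrite ler_pdivlMr ?ltr0n // mul1r -[12%:R]mulr1; apply: le_trans K_ge.
  by apply: ler_pM; rewrite ?ler0n ?ler01 ?ler_nat // exprn_ege1 // ler1n.
apply: (far_guarantee _ _ _ _ _ _ _ _ mu0) => //.
apply: le_trans (mean_signal_ge Phi z chPhi din0 zP); rewrite -/n -/d.
have den_gt0' : 0 < 4 * n ^+ 2 * d.
  by apply: mulr_gt0 d_gt0; apply: mulr_gt0 (exprn_gt0 2 n_gt0); rewrite ltr0n.
rewrite (ler_pdivlMr _ _ den_gt0').
have -> : mu0 * (4 * n ^+ 2 * d) = eps ^+ 2 / d.
  by rewrite /mu0; field; rewrite !gt_eqF.
by rewrite ler_pdivrMr // mulrC.
Qed.
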